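(* Let $R$ be a commutative unital ring, $G$ a group and $(\mathcal B_1,\Phi_1)\subseteq(\mathcal B_2,\Phi_2)$ a partial subaction of $G$ on generalized Boolean algebras, with $\Phi_k=(\{\mathcal I_{k,t}\}_{t\in G},\{\phi_{k,t}\}_{t\in G})$. Let $A_k=\mathrm{Lc}(R,\mathcal B_k)\rtimes_{\Phi_k}G$. Suppose: (1) $\mathcal B_1$ is an ideal of $\mathcal B_2$; (2) $C_1\subseteq\mathcal B_1$ is a cover of $\mathcal B_1$ and, for each $g\in G$, $C_g\subseteq\mathcal I_{2,g}$ is a cover of $\mathcal I_{2,g}$, such that for all $g\in G$, $X,Y\in C_1$ and $V\in C_{g^{-1}}$ there is $Z\in\mathcal I_{1,g}$ with $X\cap\phi_{2,g}(Y\cap V)\le Z$; (3) $A_1$ (viewed as a subalgebra of $A_2$) is contained in no proper two-sided ideal of $A_2$. Then $A_1$ and $A_2$ are Morita equivalent.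
   Context: A generalized Boolean algebra is a distributive, relatively complemented lattice with least element $0$ (joins $\cup$, meets $\cap$). An ideal is a subset closed under finite joins and under meets with arbitrary elements. A cover of $\mathcal B$ (or of an ideal $\mathcal I$) is a subset $C$ such that every element is $\le$ a finite join of elements of $C$. A partial action $\Phi$ of $G$ on $\mathcal B$ consists of ideals $\mathcal I_t$ and lattice isomorphisms $\phi_t:\mathcal I_{t^{-1}}\to\mathcal I_t$ with $\mathcal I_e=\mathcal B$, $\phi_e=\mathrm{id}$, $\phi_s(\mathcal I_{s^{-1}}\cap\mathcal I_t)=\mathcal I_s\cap\mathcal I_{st}$, and $\phi_s\phi_t=\phi_{st}$ where defined. A partial subaction $(\mathcal B_1,\Phi_1)\subseteq(\mathcal B_2,\Phi_2)$ means $\mathcal B_1$ is a sub-generalized Boolean algebra of $\mathcal B_2$, $\mathcal I_{1,t}\subseteq\mathcal I_{2,t}$ and $\phi_{2,t}$ restricts to $\phi_{1,t}$ on $\mathcal I_{1,t^{-1}}$. $\mathrm{Lc}(R,\mathcal B)$ is the commutative $R$-algebra of locally constant compactly supported $R$-valued functions on the Stone space of $\mathcal B$, spanned by idempotents $1_U$ ($U\in\mathcal B$) with $1_U1_V=1_{U\cap V}$ and $1_{U\cup V}=1_U+1_V-1_{U\cap V}$. The partial skew group ring $\mathrm{Lc}(R,\mathcal B)\rtimes_\Phi G$ is $\bigoplus_{g\in G}\mathrm{Lc}(R,\mathcal I_g)\delta_g$ (where $\mathrm{Lc}(R,\mathcal I_g)$ is the span of $1_U$, $U\in\mathcal I_g$)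 with product $(a\delta_g)(b\delta_h)=\alpha_g(\alpha_{g^{-1}}(a)b)\delta_{gh}$, $\alpha_g(1_U)=1_{\phi_g(U)}$; writing $U\delta_g$ for $1_U\delta_g$, $(U\delta_g)(V\delta_h)=\phi_g(\phi_{g^{-1}}(U)\cap V)\delta_{gh}$. It is a ring with local units $\{U\delta_e:U\in\mathcal B\}$. For a partial subaction, $A_1$ is identified with the $R$-span of $\{U\delta_g:U\in\mathcal I_{1,g}\}$ inside $A_2$. A ring with local units is a ring $R'$ with a set of commuting idempotents $E$ with $R'=\bigcup_{e\in E}eR'e$; two such rings are Morita equivalent if their categories of left modules $M$ with $R'M=M$ are equivalent. *)

(* Defs.v *)
From HB Require Import structures.
From mathcomp Require Import all_boot all_order all_algebra.
From mathcomp Require Import boolp classical_sets fsbigop.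
From Stdlib Require Import ClassicalEpsilon.
From Stdlib Require List.
Set Implicit Arguments.
Unset Strict Implicit.
Unset Printing Implicit Defensive.
Import Order.TTheory GRing.Theory.

Record abs_group := AbsGroup {
  gcar :> Type;
  gmul : gcar -> gcar -> gcar;
  ginv : gcar -> gcar;
  gone : gcar;
  gmulA : forall x y z, gmul x (gmul y z) = gmul (gmul x y) z;
  gmul1 : forall x, gmul gone x = x;
  gmulr1 : forall x, gmul x gone = x;
  gmulV : forall x, gmul (ginv x) x = gone;
  gmulrV : forall x, gmul x (ginv x) = gone }.

Local Open Scope order_scope.

Section GBA.
(* A generalized Boolean algebra = a distributive lattice with bottom and
   relative complements: MathComp's cbDistrLatticeType. Its elements play
   the role of B_2; B_1 is a subset closed under the operations. *)
Context {disp : Order.disp_t} {L : cbDistrLatticeType disp}.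

Definition sub_gba (B : set L) : Prop :=
  B \bot /\ (forall x y, B x -> B y -> B (x `|` y)) /\
  (forall x y, B x -> B y -> B (x `&` y)) /\
  (forall x y, B x -> B y -> B (x `\` y)).

Definition gba_ideal (B I : set L) : Prop :=
  (forall x, I x -> B x) /\ I \bot /\
  (forall x y, I x -> I y -> I (x `|` y)) /\
  (forall x y, I x -> B y -> I (x `&` y)).

Definition gba_cover (B C : set L) : Prop :=
  forall x, B x -> exists s : seq L,
    (forall c, List.In c s -> C c) /\ (x <= \join_(c <- s) c)%O.

Definition lattice_iso_on (I J : set L) (f : L -> L) : Prop :=
  (forall x, I x -> J (f x)) /\
  (forall x y, I x -> I y -> f x = f y -> x = y) /\
  (forall y, J y -> exists2 x, I x & f x = y) /\
  (forall x y, I x -> I y -> f (x `|` y) = f x `|` f y) /\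
  (forall x y, I x -> I y -> f (x `&` y) = f x `&` f y).

Definition partial_action (G : abs_group) (B : set L) (I : G -> set L)
    (phi : G -> L -> L) : Prop :=
  (forall t, gba_ideal B (I t)) /\
  (forall t, lattice_iso_on (I (ginv t)) (I t) (phi t)) /\
  (forall x, I (gone G) x <-> B x) /\
  (forall x, B x -> phi (gone G) x = x) /\
  (forall s t x, I (ginv s) x -> I t x ->
      I s (phi s x) /\ I (gmul s t) (phi s x)) /\
  (forall s t y, I s y -> I (gmul s t) y ->
      exists x, [/\ I (ginv s) x, I t x & phi s x = y]) /\
  (forall s t x, I (ginv t) x -> I (ginv (gmul s t)) x ->
      phi s (phi t x) = phi (gmul s t) x).

Definition partial_subaction (G : abs_group) (B1 : set L) (I1 : G -> set L)
    (phi1 : G -> L -> L) (I2 : G -> set L) (phi2 : G -> L -> L) : Prop :=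
  sub_gba B1 /\ partial_action B1 I1 phi1 /\ partial_action setT I2 phi2 /\
  (forall t x, I1 t x -> I2 t x) /\
  (forall t x, I1 (ginv t) x -> phi2 t x = phi1 t x).

(* Stone space of L: its prime filters (= ultrafilters).               *)
Definition prime_filter (xi : L -> Prop) : Prop :=
  (exists x, xi x) /\ ~ xi \bot /\
  (forall x y, xi x -> x <= y -> xi y) /\
  (forall x y, xi x -> xi y -> xi (x `&` y)) /\
  (forall x y, xi (x `|` y) -> xi x \/ xi y).

Definition stone_point := L -> Prop.

Local Open Scope ring_scope.
Variable R : comPzRingType.

(* characteristic function 1_U of the compact open set of U on the Stone space *)
Definition stone_ind (U : L) : stone_point -> R :=
  fun xi => if `[< prime_filter xi /\ xi U >] then 1 else 0.

Definition Lc_comb (s : seq (R * L)) : stone_point -> R :=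
  fun xi => \sum_(p <- s) p.1 * stone_ind p.2 xi.

Definition Lc (J : set L) (f : stone_point -> R) : Prop :=
  exists s : seq (R * L), (forall p, List.In p s -> J p.2) /\ f = Lc_comb s.

Variable G : abs_group.
Variables (I : G -> set L) (phi : G -> L -> L).

(* alpha_g : Lc(R, I_{g^-1}) -> Lc(R, I_g), the R-linear map with
   alpha_g(1_U) = 1_{phi_g(U)} *)
Definition skew_alpha (g : G) (f : stone_point -> R) : stone_point -> R :=
  epsilon (inhabits (fun _ => 0)) (fun h =>
    forall s : seq (R * L), (forall p, List.In p s -> I (ginv g) p.2) ->
      f = Lc_comb s -> h = Lc_comb [seq (p.1, phi g p.2) | p <- s]).

(* Elements of the partial skew group ring: finitely supported functions
   a : G -> Lc(R, L), a g = "coefficient of delta_g". *)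
Definition skew_elt := G -> stone_point -> R.

Definition skew_mem (J : G -> set L) (a : skew_elt) : Prop :=
  (exists s : seq G, forall g, ~ List.In g s -> a g = (fun _ => 0)) /\
  (forall g, Lc (J g) (a g)).

Definition skew_zero : skew_elt := fun _ _ => 0.
Definition skew_add (a b : skew_elt) : skew_elt := fun g xi => a g xi + b g xi.
Definition skew_opp (a : skew_elt) : skew_elt := fun g xi => - a g xi.

(* (a delta_g)(b delta_h) = alpha_g(alpha_{g^-1}(a) b) delta_{gh} *)
Definition skew_mul (a b : skew_elt) : skew_elt := fun k xi =>
  \sum_(g \in [set: {classic G}])
     skew_alpha g (fun eta => skew_alpha (ginv g) (a g) eta * b (gmul (ginv g) k) eta) xi.

End GBA.

(* Rings with local units given as a subset A of a carrier T with
   addition and multiplication; their unital left modules; Morita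
   equivalence = equivalence of the categories of unital left modules. *)
Section Morita.
Local Open Scope ring_scope.

Record lmod (T : Type) (A : T -> Prop) (addT mulT : T -> T -> T) := LMod {
  mcar :> zmodType;
  mod_act : {a : T | A a} -> mcar -> mcar;
  act_addl : forall (a b : {a : T | A a}) (Hab : A (addT (sval a) (sval b))) m,
     mod_act (exist _ _ Hab) m = mod_act a m + mod_act b m;
  act_addr : forall a m n, mod_act a (m + n) = mod_act a m + mod_act a n;
  act_mul : forall (a b : {a : T | A a}) (Hab : A (mulT (sval a) (sval b))) m,
     mod_act (exist _ _ Hab) m = mod_act a (mod_act b m);
  act_unital : forall m, exists s : seq ({a : T | A a} * mcar),
     m = \sum_(p <- s) mod_act p.1 p.2 }.

Variables (T : Type) (A : T -> Prop) (addT mulT : T -> T -> T).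
Notation Mod := (lmod A addT mulT).

Record modhom (M N : Mod) := ModHom {
  hfun :> M -> N;
  hadd : forall x y, hfun (x + y) = hfun x + hfun y;
  hact : forall a x, hfun (mod_act a x) = mod_act a (hfun x) }.

Definition hom_id (M : Mod) : modhom M M.
Proof. by exists id. Defined.

Definition hom_comp (M N P : Mod) (g : modhom N P) (f : modhom M N) :
  modhom M P.
Proof.
exists (fun x => g (f x)).
- by move=> x y; rewrite !hadd.
- by move=> a x; rewrite !hact.
Defined.
End Morita.

Record functor (T1 : Type) (A1 : T1 -> Prop) (add1 mul1 : T1 -> T1 -> T1)
               (T2 : Type) (A2 : T2 -> Prop) (add2 mul2 : T2 -> T2 -> T2) :=
  Functor {
  Fobj :> lmod A1 add1 mul1 -> lmod A2 add2 mul2;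
  Fhom : forall M N, modhom M N -> modhom (Fobj M) (Fobj N);
  Fhom_id : forall M x, Fhom (hom_id M) x = x;
  Fhom_comp : forall M N P (g : modhom N P) (f : modhom M N) x,
     Fhom (hom_comp g f) x = Fhom g (Fhom f x) }.

Definition nat_iso_id (T1 : Type) (A1 : T1 -> Prop) (add1 mul1 : T1 -> T1 -> T1)
    (T2 : Type) (A2 : T2 -> Prop) (add2 mul2 : T2 -> T2 -> T2)
    (F : functor A1 add1 mul1 A2 add2 mul2)
    (H : functor A2 add2 mul2 A1 add1 mul1) : Prop :=
  exists eta : forall M, modhom (H (F M)) M,
    (forall M, exists inv : modhom M (H (F M)),
        (forall x, eta M (inv x) = x) /\ (forall y, inv (eta M y) = y)) /\
    (forall M N (f : modhom M N) x,
        eta N (Fhom H (Fhom F f) x) = f (eta M x)).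

Definition Morita_equivalent (T1 : Type) (A1 : T1 -> Prop) (add1 mul1 : T1 -> T1 -> T1)
    (T2 : Type) (A2 : T2 -> Prop) (add2 mul2 : T2 -> T2 -> T2) : Prop :=
  exists (F : functor A1 add1 mul1 A2 add2 mul2)
         (H : functor A2 add2 mul2 A1 add1 mul1),
    nat_iso_id F H /\ nat_iso_id H F.

Definition two_sided_ideal (T : Type) (A : T -> Prop) (zeroT : T)
    (addT mulT : T -> T -> T) (oppT : T -> T) (J : T -> Prop) : Prop :=
  (forall x, J x -> A x) /\ J zeroT /\
  (forall x y, J x -> J y -> J (addT x y)) /\ (forall x, J x -> J (oppT x)) /\
  (forall a x, A a -> J x -> J (mulT a x) /\ J (mulT x a)).

(* Main.v *)
(** Conditions (1) and (2) give A1 A2 A1 <= A1, since an element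
    U delta_g of A2 cut down on both sides by X, Y in B1 becomes
    (X /\ phi_g (Y /\ V)) delta_g with V = phi_{g^-1} U,
    which by (2) lies below, and so by (1) in, the ideal I_{1,g}.  Condition (3) says
    that A2 A1 A2 = A2.  Hence A1 is a full corner of A2 up to local units, and
    N |-> A1 N, M |-> A2 A1 (x)_{A1} M are inverse equivalences.  The tensor
    product is replaced by its image in the maps from A1 A2 to M.

    Computations in A2 are done in convolution form: the dual partial action
    [pull] on prime filters turns the product of the partial skew group ring into
    (a b)_k (xi) = sum_g a_g (xi) b_{g^-1 k} (pull_g xi). *)

Require Import Defs.
From HB Require Import structures.
From mathcomp Require Import all_boot all_order all_algebra.
From mathcomp Require Import boolp classical_sets fsbigop.
From mathcomp Require Import functions.
From Stdlib Require Import ClassicalEpsilon.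
Import Order.TTheory GRing.Theory.
Set Implicit Arguments.
Unset Strict Implicit.
Unset Printing Implicit Defensive.

Local Open Scope ring_scope.

(** The image is preferred to the tensor product because its elements are functions: equality is
    tested at pairs [(x, y)], and the comparison maps, [m |-> e (x) m] and [n |-> [x y |-> x y n]],
    are defined without checking relations. Nothing is lost. Evaluation at [(e, e)] recovers [m],
    and for the other map fullness enters twice: every [n] is a sum of elements [b m] with [b] in A2
    A1 and [m] in A1 N, so that the map lands in the image; and [A1 A2 n = 0] forces [n = 0]. On the
    ring side the delicate point is associativity, which is not formal for products built from maps
    between ideals. In convolution form both bracketings of [a b c] become one double sum of
    scalars, once [pull h (pull g xi) = pull (gmul g h) xi] holds wherever the coefficients do not
    vanish. Points where [pull] is undefined need no separate bookkeeping, since every function in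
    [Lc] is 0 at the empty set. *)

Lemma eq_big_In (V : nmodType) (I : Type) (s : seq I) (f g : I -> V) :
  (forall i, List.In i s -> f i = g i) ->
  \sum_(i <- s) f i = \sum_(i <- s) g i.
Proof.
elim: s => [|i s IH] h; first by rewrite !big_nil.
rewrite !big_cons h; last by left.
by rewrite IH // => j js; apply: h; right.
Qed.

Lemma In_cat (T : Type) (s t : seq T) x :
  List.In x (s ++ t) <-> List.In x s \/ List.In x t.
Proof. exact: List.in_app_iff. Qed.

Lemma In_map (T U : Type) (f : T -> U) (s : seq T) y :
  List.In y (map f s) <-> exists x, f x = y /\ List.In x s.
Proof. exact: List.in_map_iff. Qed.

Lemma sval_inj (T : Type) (P : T -> Prop) (x y : {a | P a}) :
  sval x = sval y -> x = y.
Proof. by case: x y => [x px] [y py] /= e; apply: eq_exist. Qed.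

(** * Morita equivalence of a ring with a full corner *)

Record zclosed (V : zmodType) (P : V -> Prop) : Prop := ZClosed {
  zclosed0 : P 0;
  zclosedD : forall x y, P x -> P y -> P (x + y);
  zclosedN : forall x, P x -> P (- x) }.

(** The proof [cP] is a parameter of the type, so that the group structure built below is found from
    the type alone. *)
Record subz (V : zmodType) (P : V -> Prop) (cP : zclosed P) :=
  Subz { subz_val :> V; subz_valP : P subz_val }.

Section SubZmodule.
Variables (V : zmodType) (P : V -> Prop) (cP : zclosed P).

Lemma subz_inj (x y : subz cP) : x = y :> V -> x = y.
Proof.
case: x y => [x px] [y py] /= e; move: px py; rewrite e => px py.
by congr Subz; apply: Prop_irrelevance.
Qed.

HB.instance Definition _ := gen_eqMixin (subz cP).
HB.instance Definition _ := gen_choiceMixin (subz cP).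

Let add (x y : subz cP) : subz cP :=
  Subz cP (zclosedD cP (subz_valP x) (subz_valP y)).
Let opp (x : subz cP) : subz cP := Subz cP (zclosedN cP (subz_valP x)).
Let zero : subz cP := Subz cP (zclosed0 cP).

Let addA : associative add.
Proof. by move=> x y z; apply: subz_inj; rewrite /= addrA. Qed.
Let addC : commutative add.
Proof. by move=> x y; apply: subz_inj; rewrite /= addrC. Qed.
Let add0 : left_id zero add.
Proof. by move=> x; apply: subz_inj; rewrite /= add0r. Qed.
Let addN : left_inverse zero opp add.
Proof. by move=> x; apply: subz_inj; rewrite /= addNr. Qed.

HB.instance Definition _ := GRing.isZmodule.Build (subz cP) addA addC add0 addN.

Lemma subz_sum (I : Type) (s : seq I) (f : I -> subz cP) :
  subz_val (\sum_(i <- s) f i) = \sum_(i <- s) subz_val (f i).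
Proof. by elim: s => [|i s IH]; rewrite ?big_nil // !big_cons /= IH. Qed.

End SubZmodule.

(** [nat_iso_id] asks for maps out of [H (F M)], while both comparison maps below start from [M].
    Bijectivity provides a chosen inverse, and injectivity makes it additive, equivariant and
    natural. *)
Lemma nat_iso_id_of_bij (T1 : Type) (A1 : T1 -> Prop) (add1 mul1 : T1 -> T1 -> T1)
    (T2 : Type) (A2 : T2 -> Prop) (add2 mul2 : T2 -> T2 -> T2)
    (F : functor A1 add1 mul1 A2 add2 mul2)
    (H : functor A2 add2 mul2 A1 add1 mul1)
    (theta : forall M, modhom M (H (F M))) :
  (forall M, injective (theta M)) ->
  (forall M y, exists x, theta M x = y) ->
  (forall M N (f : modhom M N) x,
     Fhom H (Fhom F f) (theta M x) = theta N (f x)) ->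
  nat_iso_id F H.
Proof.
move=> inj surj nat.
pose inv M y := sval (cid (surj M y)).
have invK M y : theta M (inv M y) = y by rewrite /inv; case: cid.
have invD M x y : inv M (x + y) = inv M x + inv M y.
  by apply: inj; rewrite hadd !invK.
have invA M a x : inv M (mod_act a x) = mod_act a (inv M x).
  by apply: inj; rewrite hact !invK.
exists (fun M => ModHom (invD M) (invA M)); split=> [M|M N f x] /=.
  by exists (theta M); split=> [x|y]; [apply: inj|]; rewrite invK.
by apply: inj; rewrite invK -nat invK.
Qed.

(** The laws are imposed on members of [A] only: [skew_mul], defined through a choice operator and
    finitely supported sums, is under control only there. *)
Record is_rng (T : Type) (A : T -> Prop) (zero : T) (add : T -> T -> T)
    (opp : T -> T) (mul : T -> T -> T) : Prop := IsRng {
  rng0 : A zero;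
  rngD : forall x y, A x -> A y -> A (add x y);
  rngN : forall x, A x -> A (opp x);
  rngM : forall x y, A x -> A y -> A (mul x y);
  rng_add00 : add zero zero = zero;
  rng_addN : forall x, A x -> add x (opp x) = zero;
  rng_mulA : forall x y z, A x -> A y -> A z ->
    mul x (mul y z) = mul (mul x y) z;
  rng_mulDl : forall x y z, A x -> A y -> A z ->
    mul (add x y) z = add (mul x z) (mul y z);
  rng_mulDr : forall x y z, A x -> A y -> A z ->
    mul x (add y z) = add (mul x y) (mul x z) }.

(** Finite lists rather than single elements, so that a sum is handled by one unit common to all of
    its terms. *)
Definition local_units (T : Type) (A : T -> Prop) (mul : T -> T -> T) :=
  forall s : seq T, (forall a, List.In a s -> A a) ->
  exists2 e, A e & forall a, List.In a s -> mul e a = a /\ mul a e = a.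

(** * Unital modules over a ring with local units *)

Section Action.
Variables (T : Type) (A : T -> Prop) (add mul : T -> T -> T).
Notation Mod := (lmod A add mul).

(* The action extended by 0 to all of T, which avoids carrying proofs of A a. *)
Definition act (M : Mod) (a : T) (m : M) : M :=
  if pselect (A a) is left h then mod_act (exist _ a h) m else 0.

Lemma mod_actE (M : Mod) (a : {a | A a}) (m : M) : mod_act a m = act (sval a) m.
Proof.
case: a => a h; rewrite /act /=; case: pselect => // h'.
by congr (mod_act _ _); apply: sval_inj.
Qed.

Lemma actDr (M : Mod) a (m n : M) : act a (m + n) = act a m + act a n.
Proof. by rewrite /act; case: pselect => h; rewrite ?addr0 // act_addr. Qed.

Lemma act0 (M : Mod) a : act a (0 : M) = 0.
Proof. by apply: (addIr (act a 0)); rewrite -actDr !add0r. Qed.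

Lemma actNr (M : Mod) a (m : M) : act a (- m) = - act a m.
Proof. by apply: (addrI (act a m)); rewrite -actDr !subrr act0. Qed.

Lemma act_sum (M : Mod) a (I : Type) (s : seq I) (f : I -> M) :
  act a (\sum_(i <- s) f i) = \sum_(i <- s) act a (f i).
Proof.
by elim: s => [|i s IH]; rewrite ?big_nil ?act0 // !big_cons actDr IH.
Qed.

Lemma actDl (M : Mod) a b (m : M) : A a -> A b -> A (add a b) ->
  act (add a b) m = act a m + act b m.
Proof.
move=> ha hb hab.
by rewrite -[act (add a b) m](mod_actE (exist _ _ hab))
  (@act_addl _ _ _ _ M (exist _ a ha) (exist _ b hb) hab) !mod_actE.
Qed.

Lemma actM (M : Mod) a b (m : M) : A a -> A b -> A (mul a b) ->
  act (mul a b) m = act a (act b m).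
Proof.
move=> ha hb hab.
by rewrite -[act (mul a b) m](mod_actE (exist _ _ hab))
  (@act_mul _ _ _ _ M (exist _ a ha) (exist _ b hb) hab) !mod_actE.
Qed.

Lemma hom0 (M N : Mod) (f : modhom M N) : f 0 = 0.
Proof. by apply: (addIr (f 0)); rewrite -hadd !add0r. Qed.

Lemma hom_sum (M N : Mod) (f : modhom M N) (I : Type) (s : seq I) (g : I -> M) :
  f (\sum_(i <- s) g i) = \sum_(i <- s) f (g i).
Proof.
by elim: s => [|i s IH]; rewrite ?big_nil ?hom0 // !big_cons hadd IH.
Qed.

Lemma hom_act (M N : Mod) (f : modhom M N) a m : f (act a m) = act a (f m).
Proof. by rewrite /act; case: pselect => h; rewrite ?hom0 // hact. Qed.

Hypothesis luA : local_units A mul.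

(** Unitality writes each [m] as a finite sum of terms [a n]. A local unit common to all these
    coefficients [a] and to [s] fixes everything at once. *)
Lemma act_local_units (M : Mod) (s : seq T) (ms : seq M) :
  (forall a, List.In a s -> A a) ->
  exists e, [/\ A e, forall a, List.In a s -> mul e a = a /\ mul a e = a
     & forall m, List.In m ms -> act e m = m].
Proof.
move=> sA.
have [t tA tms] : exists2 t : seq T, forall a, List.In a t -> A a &
    forall e, A e -> (forall a, List.In a t -> mul e a = a) ->
      forall m, List.In m ms -> act e m = m.
  elim: ms => [|m ms [t tA IH]]; first by exists [::].
  have [u mE] := act_unital m.
  exists ([seq sval p.1 | p <- u] ++ t) => [a /In_cat []|e eA eu n].
  - by move=> /In_map[p [<- _]]; case: (p.1).
  - exact: tA.
  - case=> [<-|]; last by apply: IH => // a at_; apply: eu; apply/In_cat; right.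
    rewrite mE act_sum; apply: eq_big_In => p pu.
    have ep : mul e (sval p.1) = sval p.1.
      apply: eu; apply/In_cat; left; apply/In_map.
      by exists p.
    rewrite mod_actE -actM ?ep //; exact: (svalP p.1).
have [a /In_cat[]|e eA eu] := luA (s := s ++ t); [exact: sA|exact: tA|].
exists e; split=> [//|a as_|].
  by apply: eu; apply/In_cat; left.
apply: tms => // a at_; apply: (proj1 (eu a _)).
by apply/In_cat; right.
Qed.

Lemma act_local_unit (M : Mod) (m : M) : exists2 e, A e & act e m = m.
Proof.
have [//|e [eA _ em]] := @act_local_units M [::] [:: m].
by exists e => //; apply: em; left.
Qed.

End Action.

Section CornerMorita.
Variables (T : Type) (zero : T) (add : T -> T -> T) (opp : T -> T).
Variables (mul : T -> T -> T) (A1 A2 : T -> Prop).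
Hypothesis rngA : is_rng A2 zero add opp mul.
Hypothesis lu1 : local_units A1 mul.
Hypothesis lu2 : local_units A2 mul.
Hypothesis sub12 : forall a, A1 a -> A2 a.
Hypothesis corner : forall a x b, A1 a -> A2 x -> A1 b -> A1 (mul (mul a x) b).
Hypothesis full : forall J : T -> Prop,
  two_sided_ideal A2 zero add mul opp J ->
  (forall a, A1 a -> J a) -> forall a, A2 a -> J a.

Local Notation "x ** y" := (mul x y) (at level 40, left associativity).
Local Notation mod1 := (lmod A1 add mul).
Local Notation mod2 := (lmod A2 add mul).

Let M2 x y : A2 x -> A2 y -> A2 (x ** y) := rngM rngA (x := x) (y := y).
Let mA := rng_mulA rngA.

Lemma unit1 x : A1 x -> exists e, [/\ A1 e, e ** x = x & x ** e = x].
Proof.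
move=> x1; have [a [<-|//]|e e1 eu] := lu1 (s := [:: x]); first exact: x1.
by exists e; case: (eu x); [left|].
Qed.

(** A local unit inserted between the two factors brings the product into the form required by
    [corner]. *)
Lemma corner_mul x y : A1 x -> A1 y -> A1 (x ** y).
Proof.
move=> x1 y1; have [e [e1 _ xe]] := unit1 x1.
by rewrite -xe; apply: corner => //; apply: sub12.
Qed.

Let act1A (M : mod1) a b (m : M) : A1 a -> A1 b -> act (a ** b) m = act a (act b m).
Proof. by move=> a1 b1; apply: actM => //; apply: corner_mul. Qed.

Let act2A (N : mod2) a b (n : N) : A2 a -> A2 b -> act (a ** b) n = act a (act b n).
Proof. by move=> a2 b2; apply: actM => //; apply: M2. Qed.

Lemma act_zero (N : mod2) (n : N) : act zero n = 0.
Proof.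
have z := rng0 rngA.
by apply: (addIr (act zero n)); rewrite -actDl ?(rng_add00 rngA) // add0r.
Qed.

Lemma act_opp (N : mod2) a (n : N) : A2 a -> act (opp a) n = - act a n.
Proof.
move=> a2; have o2 := rngN rngA a2.
have z2 : A2 (add a (opp a)) by rewrite (rng_addN rngA) //; exact: (rng0 rngA).
by apply: (addrI (act a n)); rewrite -actDl // (rng_addN rngA) // act_zero subrr.
Qed.

(* Membership in A1 N: local units make a single e suffice, no sums being needed. *)
Definition in_corner (N : mod2) (n : N) : Prop := exists2 e, A1 e & act e n = n.

Lemma in_corner_act (N : mod2) a (n : N) : A1 a -> in_corner (act a n).
Proof.
move=> a1; have [e [e1 ea _]] := unit1 a1.
exists e => //; rewrite -act2A ?ea //; exact: sub12.
Qed.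

Lemma in_corner_closed (N : mod2) : zclosed (@in_corner N).
Proof.
(* A unit for the empty list: it only shows that [A1] is inhabited, which membership of 0
   requires. *)
have [|e0 e01 _] := lu1 (s := [::]); first by [].
split=> [|x y [e e1 ex] [f f1 fy]|x [e e1 ex]].
- by exists e0 => //; exact: act0.
- have [a [<-//|[<-//|//]]|g g1 gu] := lu1 (s := [:: e; f]).
  have [ge _] := gu e (or_introl erefl).
  have [gf _] := gu f (or_intror (or_introl erefl)).
  exists g => //; rewrite actDr -{1}ex -{1}fy -!act2A ?ge ?gf ?ex ?fy //; exact: sub12.
- by exists e => //; rewrite actNr ex.
Qed.

Definition corner_act (N : mod2) (a : {a | A1 a}) (n : subz (in_corner_closed N)) :
    subz (in_corner_closed N) :=
  Subz (in_corner_closed N) (in_corner_act (subz_val n) (svalP a)).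

Lemma corner_act_addl (N : mod2) (a b : {a | A1 a}) (hab : A1 (add (sval a) (sval b)))
    (n : subz (in_corner_closed N)) :
  corner_act (exist _ _ hab) n = corner_act a n + corner_act b n.
Proof.
apply: subz_inj; rewrite /= actDl //; [| |exact: sub12]; apply: sub12; exact: svalP.
Qed.

Lemma corner_act_addr (N : mod2) a (m n : subz (in_corner_closed N)) :
  corner_act a (m + n) = corner_act a m + corner_act a n.
Proof. by apply: subz_inj; rewrite /= actDr. Qed.

Lemma corner_act_mul (N : mod2) (a b : {a | A1 a}) (hab : A1 (mul (sval a) (sval b)))
    (n : subz (in_corner_closed N)) :
  corner_act (exist _ _ hab) n = corner_act a (corner_act b n).
Proof.
apply: subz_inj; rewrite /= act2A //; apply: sub12; exact: svalP.
Qed.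

Lemma corner_act_unital (N : mod2) (n : subz (in_corner_closed N)) :
  exists s : seq ({a | A1 a} * subz (in_corner_closed N)),
    n = \sum_(p <- s) corner_act p.1 p.2.
Proof.
have [e e1 en] := subz_valP n.
exists [:: (exist _ e e1, n)]; rewrite big_seq1.
by apply: subz_inj; rewrite /= en.
Qed.

Definition corner_mod (N : mod2) : mod1 :=
  LMod (@corner_act_addl N) (@corner_act_addr N) (@corner_act_mul N)
    (@corner_act_unital N).

Lemma corner_mod_act (N : mod2) a (n : corner_mod N) : A1 a ->
  subz_val (act a n) = act a (subz_val n).
Proof. by move=> a1; rewrite -(mod_actE (exist _ a a1)). Qed.

Lemma corner_hom_subproof (N N' : mod2) (f : modhom N N') (n : corner_mod N) :
  in_corner (f (subz_val n)).
Proof. by have [e e1 en] := subz_valP n; exists e => //; rewrite -hom_act en. Qed.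

Definition corner_hom_fun (N N' : mod2) (f : modhom N N') (n : corner_mod N) :
  corner_mod N' := Subz (in_corner_closed N') (corner_hom_subproof f n).

Lemma corner_hom_add (N N' : mod2) (f : modhom N N') m n :
  corner_hom_fun f (m + n) = corner_hom_fun f m + corner_hom_fun f n.
Proof. by apply: subz_inj; rewrite /= hadd. Qed.

Lemma corner_hom_act (N N' : mod2) (f : modhom N N') a n :
  corner_hom_fun f (mod_act a n) = mod_act a (corner_hom_fun f n).
Proof. by apply: subz_inj; rewrite /= hom_act. Qed.

Definition corner_hom (N N' : mod2) (f : modhom N N') :
    modhom (corner_mod N) (corner_mod N') :=
  ModHom (corner_hom_add f) (corner_hom_act f).

Definition corner_functor : functor A2 add mul A1 add mul.
Proof.
by exists corner_mod corner_hom => [M x|M N P g f x]; apply: subz_inj.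
Defined.

(* The functor from A1-modules to A2-modules sends M to the image of
   A2 A1 (x) M in the maps from A1 A2 to M, b (x) m being sent to
   [x y |-> (x y b) m]; elements of A1 A2 are represented by pairs (x, y). *)
Definition pairs := ({a | A1 a} * {a | A2 a})%type.

(** Membership in A2 A1: a sum of products [b_i y_i] is fixed on the right by one local unit of all
    the [y_i], so a single [y] is enough. *)
Definition right_corner b := A2 b /\ exists2 y, A1 y & b ** y = b.

Definition ind_gen (M : mod1) (b : T) (m : M) : pairs -> M :=
  fun p => act ((sval p.1 ** sval p.2) ** b) m.

Definition ind_comb (M : mod1) (s : seq (T * M)) : pairs -> M :=
  fun q => \sum_(p <- s) ind_gen p.1 p.2 q.

Definition in_ind (M : mod1) (f : pairs -> M) : Prop :=
  exists2 s : seq (T * M), forall p, List.In p s -> right_corner p.1 &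
    f = ind_comb s.

Lemma right_corner1 a : A1 a -> right_corner a.
Proof.
by move=> a1; split; [exact: sub12|have [e [e1 _ ae]] := unit1 a1; exists e].
Qed.

Lemma right_cornerM c b : A2 c -> right_corner b -> right_corner (c ** b).
Proof.
move=> c2 [b2 [y y1 by_]]; split; first exact: M2.
by exists y => //; rewrite -mA ?by_ //; exact: sub12.
Qed.

Lemma corner_right a b : A1 a -> right_corner b -> A1 (a ** b).
Proof.
move=> a1 [b2 [y y1 by_]]; have y2 := sub12 y1; have a2 := sub12 a1.
by rewrite -by_ mA //; apply: corner.
Qed.

(** With [b = b z], the product is [x (y b) z], an element of the corner. Hence the values of
    [ind_gen] use the true action on [M] and not the default value 0 of [act]. *)
Lemma corner_pair (x : {a | A1 a}) (y : {a | A2 a}) b : right_corner b ->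
  A1 ((sval x ** sval y) ** b).
Proof.
move=> [b2 [z z1 bz]]; have z2 := sub12 z1; have x2 := sub12 (svalP x).
have y2 := svalP y.
have -> : sval x ** sval y ** b = sval x ** (sval y ** b) ** z.
  by rewrite -!mA ?bz //; exact: M2.
by apply: corner => //; [exact: svalP|exact: M2].
Qed.

Lemma in_ind_closed (M : mod1) : zclosed (@in_ind M).
Proof.
split=> [|f g [s sP ->] [t tP ->]|f [s sP ->]].
- by exists [::] => //; apply/funext => q; rewrite /ind_comb big_nil.
- exists (s ++ t) => [p /In_cat[/sP|/tP]//|].
  by apply/funext => q; rewrite /ind_comb big_cat.
- exists [seq (p.1, - p.2) | p <- s] => [p /In_map[q [<- /sP]]//|].
  apply/funext => q; rewrite /ind_comb big_map opprfctE /= -sumrN.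
  by apply: eq_bigr => p _; rewrite /ind_gen actNr.
Qed.

Definition mul2 (a b : {a | A2 a}) : {a | A2 a} :=
  exist _ (sval a ** sval b) (M2 (svalP a) (svalP b)).

(** Right multiplication by [c] in the second component becomes, by precomposition, a left action of
    A2; on generators it sends [b (x) m] to [c b (x) m]. *)
Definition ind_shift (M : mod1) (c : {a | A2 a}) (f : pairs -> M) : pairs -> M :=
  fun p => f (p.1, mul2 p.2 c).

Lemma ind_gen_shift (M : mod1) (c : {a | A2 a}) b (m : M) : A2 b ->
  ind_shift c (ind_gen b m) = ind_gen (sval c ** b) m.
Proof.
move=> b2; apply/funext => -[x y]; rewrite /ind_shift /ind_gen /=.
have x2 := sub12 (svalP x); have y2 := svalP y; have c2 := svalP c.
by rewrite !mA //; exact: M2.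
Qed.

Lemma in_ind_shift (M : mod1) c (f : pairs -> M) : in_ind f -> in_ind (ind_shift c f).
Proof.
move=> [s sP ->]; exists [seq (sval c ** p.1, p.2) | p <- s].
  move=> p /In_map[q [<- /sP]] /=; apply: right_cornerM; exact: svalP.
apply/funext => q; rewrite /ind_comb big_map; apply: eq_big_In => p ps /=.
by rewrite -ind_gen_shift //; case: (sP p ps).
Qed.

Definition ind_act (M : mod1) (c : {a | A2 a}) (f : subz (in_ind_closed M)) :
    subz (in_ind_closed M) :=
  Subz (in_ind_closed M) (in_ind_shift c (subz_valP f)).

Lemma ind_act_addl (M : mod1) (a b : {a | A2 a}) (hab : A2 (add (sval a) (sval b)))
    (f : subz (in_ind_closed M)) :
  ind_act (exist _ _ hab) f = ind_act a f + ind_act b f.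
Proof.
apply: subz_inj => /=; have [s sP ->] := subz_valP f.
apply/funext => -[x y]; rewrite /ind_shift /ind_comb /= addrfctE -big_split.
apply: eq_big_In => p /sP pc /=; rewrite /ind_gen /=.
have x2 := sub12 (svalP x); have y2 := svalP y; have a2 := svalP a.
have b2 := svalP b; have [p2 _] := pc.
have E : sval x ** (sval y ** add (sval a) (sval b)) ** p.1 =
  add (sval x ** (sval y ** sval a) ** p.1) (sval x ** (sval y ** sval b) ** p.1).
  by rewrite (rng_mulDr rngA) // (rng_mulDr rngA) ?(rng_mulDl rngA) //; do ?apply: M2.
rewrite E actDl // -?E; [exact: (corner_pair x (mul2 y a) pc)
  |exact: (corner_pair x (mul2 y b) pc)|].
exact: (corner_pair x (mul2 y (exist _ _ hab)) pc).
Qed.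

Lemma ind_act_addr (M : mod1) a (f g : subz (in_ind_closed M)) :
  ind_act a (f + g) = ind_act a f + ind_act a g.
Proof. exact: subz_inj. Qed.

Lemma ind_act_mul (M : mod1) (a b : {a | A2 a}) (hab : A2 (mul (sval a) (sval b)))
    (f : subz (in_ind_closed M)) :
  ind_act (exist _ _ hab) f = ind_act a (ind_act b f).
Proof.
apply: subz_inj => /=; apply/funext => -[x y]; rewrite /ind_shift /=.
congr (subz_val f (_, _)); apply: sval_inj => /=; apply: mA; exact: svalP.
Qed.

Lemma ind_act_unital (M : mod1) (f : subz (in_ind_closed M)) :
  exists s : seq ({a | A2 a} * subz (in_ind_closed M)),
    f = \sum_(p <- s) ind_act p.1 p.2.
Proof.
have [s sP fE] := subz_valP f.
have [a|e e2 eu] := lu2 (s := [seq p.1 | p <- s]).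
  by move=> /In_map[p [<- /sP[]]].
exists [:: (exist _ e e2, f)]; rewrite big_seq1; apply: subz_inj => /=.
rewrite fE; apply/funext => q; apply: eq_big_In => p ps.
have [p2 _] := sP p ps.
rewrite -[RHS]/(ind_shift (exist _ e e2) (ind_gen p.1 p.2) q).
rewrite ind_gen_shift //= (proj1 (eu p.1 _)) //.
by apply/In_map; exists p.
Qed.

Definition ind_mod (M : mod1) : mod2 :=
  LMod (@ind_act_addl M) (@ind_act_addr M) (@ind_act_mul M) (@ind_act_unital M).

Lemma ind_hom_subproof (M N : mod1) (f : modhom M N) (g : ind_mod M) :
  in_ind (f \o subz_val g).
Proof.
have [s sP ->] := subz_valP g.
exists [seq (p.1, f p.2) | p <- s] => [p /In_map[q [<- /sP]]//|].
apply/funext => q; rewrite /ind_comb /= big_map hom_sum.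
by apply: eq_bigr => p _; rewrite /ind_gen hom_act.
Qed.

Definition ind_hom_fun (M N : mod1) (f : modhom M N) (g : ind_mod M) : ind_mod N :=
  Subz (in_ind_closed N) (ind_hom_subproof f g).

Lemma ind_hom_add (M N : mod1) (f : modhom M N) g h :
  ind_hom_fun f (g + h) = ind_hom_fun f g + ind_hom_fun f h.
Proof. by apply: subz_inj; apply/funext => q; rewrite /= hadd. Qed.

Lemma ind_hom_act (M N : mod1) (f : modhom M N) a g :
  ind_hom_fun f (mod_act a g) = mod_act a (ind_hom_fun f g).
Proof. exact: subz_inj. Qed.

Definition ind_hom (M N : mod1) (f : modhom M N) : modhom (ind_mod M) (ind_mod N) :=
  ModHom (ind_hom_add f) (ind_hom_act f).

Definition ind_functor : functor A1 add mul A2 add mul.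
Proof.
by exists ind_mod ind_hom => [M x|M N P g f x]; apply: subz_inj.
Defined.

(** Both sides are compared with a common unit [g]: if [g a = a] and [a m = m], then
    [(x y a) m = (x y g) (a m) = (x y g) m]. The inserted [g] keeps all factors in A1, where they
    act on [M]. *)
Lemma ind_gen_unit (M : mod1) e e' (m : M) : A1 e -> A1 e' ->
  act e m = m -> act e' m = m -> ind_gen e m = ind_gen e' m.
Proof.
move=> e1 e'1 em e'm.
have [a [<-//|[<-//|//]]|g g1 gu] := lu1 (s := [:: e; e']).
have [ge _] := gu e (or_introl erefl).
have [ge' _] := gu e' (or_intror (or_introl erefl)).
have gm a : A1 a -> act a m = m -> g ** a = a -> ind_gen a m = ind_gen g m.
  move=> a1 am ga; apply/funext => -[x y]; rewrite /ind_gen /= -{1}ga.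
  have x2 := sub12 (svalP x); have y2 := svalP y.
  rewrite mA; [|exact: M2|exact: sub12|exact: sub12].
  by rewrite act1A ?am //; apply: corner_pair; exact: right_corner1.
by rewrite (gm e) ?(gm e').
Qed.

(* The element e (x) m of A2 A1 (x) M, which by [ind_gen_unit] does not depend
   on the choice of e in A1 with e m = m. *)
Definition ind_point (M : mod1) (m : M) : pairs -> M :=
  ind_gen (s2val (cid2 (act_local_unit lu1 m))) m.

Lemma ind_pointE (M : mod1) (m : M) e : A1 e -> act e m = m ->
  ind_point m = ind_gen e m.
Proof. by move=> e1 em; rewrite /ind_point; case: cid2 => f f1 fm; exact: ind_gen_unit. Qed.

Lemma in_ind_gen (M : mod1) b (m : M) : right_corner b -> in_ind (ind_gen b m).
Proof.
move=> bc; exists [:: (b, m)] => [p [<-|]//|].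
by apply/funext => q; rewrite /ind_comb big_seq1.
Qed.

Lemma in_ind_point (M : mod1) (m : M) : in_ind (ind_point m).
Proof.
have [e e1 em] := act_local_unit lu1 m.
by rewrite (ind_pointE e1 em); apply: in_ind_gen; exact: right_corner1.
Qed.

(** Choose one [e] that fixes [m] and [a m] and is a two-sided unit of [a]; then
    [e (x) a m = e a (x) m = a e (x) m]. *)
Lemma ind_point_act (M : mod1) (m : M) (a : {a | A1 a}) :
  ind_point (act (sval a) m) =
  ind_shift (exist _ (sval a) (sub12 (svalP a))) (ind_point m).
Proof.
have [b [<-|//]|e [e1 eu em]] := act_local_units lu1 [:: m; act (sval a) m]
  (s := [:: sval a]); first exact: svalP.
have [ea ae] := eu _ (or_introl erefl).
rewrite (@ind_pointE _ m e) //; last by apply: em; left.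
rewrite (@ind_pointE _ _ e) //; last by apply: em; right; left.
rewrite ind_gen_shift; last exact: sub12.
apply/funext => -[x y]; rewrite /ind_gen /= ae.
have x2 := sub12 (svalP x); have y2 := svalP y.
rewrite -act1A; [|apply: corner_pair; exact: right_corner1|exact: svalP].
by rewrite -mA ?ea //; [exact: M2|exact: sub12|exact: sub12 (svalP a)].
Qed.

Lemma in_corner_point (M : mod1) (m : M) :
  in_corner (Subz (in_ind_closed M) (in_ind_point m) : ind_mod M).
Proof.
have [e e1 em] := act_local_unit lu1 m.
exists e => //; rewrite -(mod_actE (exist _ e (sub12 e1))); apply: subz_inj => /=.
by have := ind_point_act m (exist _ e e1); rewrite /= em.
Qed.

Definition point_fun (M : mod1) (m : M) : corner_mod (ind_mod M) :=
  Subz (in_corner_closed (ind_mod M)) (in_corner_point m).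

Lemma point_fun_add (M : mod1) (m n : M) :
  point_fun (m + n) = point_fun m + point_fun n.
Proof.
do 2!apply: subz_inj => /=.
have [//|e [e1 _ em]] := act_local_units lu1 [:: m; n] (s := [::]).
have em1 := em m (or_introl erefl).
have en1 := em n (or_intror (or_introl erefl)).
rewrite !(@ind_pointE _ _ e) ?actDr ?em1 ?en1 //.
by apply/funext => q; rewrite /ind_gen actDr.
Qed.

Lemma point_fun_act (M : mod1) a (m : M) :
  point_fun (mod_act a m) = mod_act a (point_fun m).
Proof.
do 2!apply: subz_inj => /=; rewrite mod_actE ind_point_act.
by rewrite -(mod_actE (exist _ (sval a) (sub12 (svalP a)))).
Qed.

Definition point_hom (M : mod1) : modhom M (corner_mod (ind_mod M)) :=
  ModHom (@point_fun_add M) (@point_fun_act M).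

(** Evaluation at the pair [(e, e)] returns [e e e m = m]. *)
Lemma point_inj (M : mod1) : injective (point_hom M).
Proof.
move=> m n /(congr1 (fun f => subz_val (subz_val f))) /= mn.
have [//|e [e1 _ em]] := act_local_units lu1 [:: m; n] (s := [::]).
have em1 := em m (or_introl erefl).
have en1 := em n (or_intror (or_introl erefl)).
have := congr1 (fun f => f (exist _ e e1, exist _ e (sub12 e1))) mn.
rewrite !(@ind_pointE _ _ e) // /ind_gen /=.
by rewrite !act1A ?em1 ?en1 //; exact: corner_mul.
Qed.

(** If [y = e y] is the sum of the [b_i (x) m_i], it is also the sum of the [e b_i (x) m_i], where
    [e b_i] lies in A1. A common unit [f] of the [e b_i] then gives [y = f (x) m] with [m] the sum
    of the [e b_i m_i]. *)
Lemma point_surj (M : mod1) y : exists m, point_hom M m = y.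
Proof.
have [e e1 ey] := subz_valP y.
have [s sP yE] := subz_valP (subz_val y).
pose t := [seq e ** p.1 | p <- s].
have [a /In_map[p [<- /sP]]|f f1 fu] := lu1 (s := t).
  exact: corner_right.
pose m := \sum_(p <- s) act (e ** p.1) p.2.
have ft p : List.In p s -> f ** (e ** p.1) = e ** p.1.
  by move=> ps; apply: (proj1 (fu _ _)); apply/In_map; exists p.
have fm : act f m = m.
  rewrite act_sum; apply: eq_big_In => p ps.
  by rewrite -act1A ?ft //; apply: corner_right => //; exact: sP.
exists m; do 2!apply: subz_inj => /=; rewrite (ind_pointE f1 fm).
rewrite -ey -(mod_actE (exist _ e (sub12 e1))) /= yE.
apply/funext => -[x z]; rewrite /ind_shift /= /ind_gen act_sum /=.
apply: eq_big_In => p ps; have [p2 _] := sP p ps.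
have x2 := sub12 (svalP x); have z2 := svalP z; have e2 := sub12 e1.
have f2 := sub12 f1.
rewrite -act1A; [|by apply: corner_pair; exact: right_corner1|
  by apply: corner_right => //; exact: sP].
rewrite -[_ ** f ** _]mA ?ft //; do ?exact: M2.
by rewrite /ind_gen /= !mA //; exact: M2.
Qed.

(** * The isomorphism from N to the module induced from A1 N *)

Definition corner_span (N : mod2) (n : N) : Prop :=
  exists2 s : seq (T * corner_mod N), forall p, List.In p s -> right_corner p.1 &
    n = \sum_(p <- s) act p.1 (subz_val p.2).

Lemma corner_span_closed (N : mod2) : zclosed (@corner_span N).
Proof.
split=> [|f g [s sP ->] [t tP ->]|f [s sP ->]].
- by exists [::] => //; rewrite big_nil.
- by exists (s ++ t) => [p /In_cat[/sP|/tP]//|]; rewrite big_cat.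
- exists [seq (p.1, - p.2) | p <- s] => [p /In_map[q [<- /sP]]//|].
  by rewrite big_map /= -sumrN; apply: eq_bigr => p _; rewrite actNr.
Qed.

(* The a in A2 with a N inside A2 A1 N form an ideal containing A1. *)
Lemma corner_spanT (N : mod2) (n : N) : corner_span n.
Proof.
have [e e2 <-] := act_local_unit lu2 n.
have [c0 cD cN] := corner_span_closed N.
suff: A2 e /\ forall n : N, corner_span (act e n) by case.
apply: (full (J := fun x => A2 x /\ forall n : N, corner_span (act x n))) => //.
  split; first by move=> x [].
  split; first by split=> [|k]; [exact: (rng0 rngA)|rewrite act_zero].
  split=> [x y [x2 xs] [y2 ys]|].
    have D := rngD rngA x2 y2; split=> // k.
    by rewrite actDl //; apply: cD.
  split=> [x [x2 xs]|a x a2 [x2 xs]].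
    by split=> [|k]; [exact: (rngN rngA)|rewrite act_opp //; exact: cN].
  split; (split; first exact: M2) => k; rewrite act2A //.
  have [s sP ->] := xs k; exists [seq (a ** p.1, p.2) | p <- s].
    by move=> p /In_map[q [<- /sP]]; apply: right_cornerM.
  rewrite act_sum big_map; apply: eq_big_In => p /sP[p2 _] /=.
  by rewrite act2A.
move=> a a1; split=> [|k]; first exact: sub12.
have [f [f1 fa _]] := unit1 a1.
exists [:: (f, Subz (in_corner_closed N) (in_corner_act k a1))].
  by move=> p [<-|//]; exact: right_corner1.
by rewrite big_seq1 /= -act2A ?fa //; exact: sub12.
Qed.

(** The map [x y |-> x y n] depends on [n] alone and not on a presentation of [n] in A2 A1 N; such a
    presentation serves only to place the map in the image. *)
Definition eval_fun_val (N : mod2) (n : N) : pairs -> corner_mod N :=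
  fun p => Subz (in_corner_closed N) (in_corner_act (act (sval p.2) n) (svalP p.1)).

Lemma eval_sum (N : mod2) (s : seq (T * corner_mod N)) :
  (forall p, List.In p s -> right_corner p.1) ->
  eval_fun_val (\sum_(p <- s) act p.1 (subz_val p.2)) = ind_comb s.
Proof.
move=> sP; apply/funext => -[x y]; apply: subz_inj.
rewrite /= /ind_comb subz_sum !act_sum; apply: eq_big_In => p /sP pc.
rewrite /ind_gen /= corner_mod_act; last exact: corner_pair.
have [p2 _] := pc; have x2 := sub12 (svalP x); have y2 := svalP y.
by rewrite !act2A //; exact: M2.
Qed.

Lemma in_ind_eval (N : mod2) (n : N) : in_ind (eval_fun_val n).
Proof.
by have [s sP ->] := corner_spanT n; exists s => //; exact: eval_sum.
Qed.

Definition eval_fun (N : mod2) (n : N) : ind_mod (corner_mod N) :=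
  Subz (in_ind_closed (corner_mod N)) (in_ind_eval n).

Lemma eval_fun_add (N : mod2) (m n : N) : eval_fun (m + n) = eval_fun m + eval_fun n.
Proof.
by apply: subz_inj; apply/funext => q; apply: subz_inj; rewrite /= !actDr.
Qed.

Lemma eval_fun_act (N : mod2) a (n : N) : eval_fun (mod_act a n) = mod_act a (eval_fun n).
Proof.
apply: subz_inj; apply/funext => -[x y]; apply: subz_inj => /=.
by rewrite mod_actE act2A //; exact: svalP.
Qed.

Definition eval_hom (N : mod2) : modhom N (ind_mod (corner_mod N)) :=
  ModHom (@eval_fun_add N) (@eval_fun_act N).

(** The [x] in A2 that kill A2 n form a two-sided ideal containing A1. Killing A2 n, and not only
    [n], is what makes it stable under right multiplication. *)
Lemma annihilator0 (N : mod2) (n : N) :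
  (forall x y, A1 x -> A2 y -> act x (act y n) = 0) -> n = 0.
Proof.
move=> n0; have [e e2 en] := act_local_unit lu2 n.
suff: A2 e /\ forall y, A2 y -> act e (act y n) = 0.
  by case=> _ /(_ e e2); rewrite !en.
apply: (full (J := fun x => A2 x /\ forall y, A2 y -> act x (act y n) = 0)) => //.
  split; first by move=> x [].
  split; first by split=> [|k _]; [exact: (rng0 rngA)|rewrite act_zero].
  split=> [x y [x2 xs] [y2 ys]|].
    have D := rngD rngA x2 y2; split=> // k k2.
    by rewrite actDl // xs // ys // addr0.
  split=> [x [x2 xs]|a x a2 [x2 xs]].
    by split=> [|k k2]; [exact: (rngN rngA)|rewrite act_opp // xs // oppr0].
  split; (split; first exact: M2) => k k2; rewrite act2A //.
    by rewrite xs // act0.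
  by rewrite -(act2A _ a2) // xs //; exact: M2.
by move=> a a1; split=> [|k k2]; [exact: sub12|exact: n0].
Qed.

Lemma eval_inj (N : mod2) : injective (eval_hom N).
Proof.
move=> m n mn; apply/eqP; rewrite -subr_eq0; apply/eqP.
apply: annihilator0 => x y x1 y2; rewrite !actDr !actNr; apply/eqP.
rewrite subr_eq0; apply/eqP.
exact: (congr1 (fun f => subz_val (subz_val f (exist _ x x1, exist _ y y2))) mn).
Qed.

Lemma eval_surj (N : mod2) y : exists n, eval_hom N n = y.
Proof.
have [s sP yE] := subz_valP y.
exists (\sum_(p <- s) act p.1 (subz_val p.2)).
by apply: subz_inj; rewrite /= eval_sum.
Qed.

Theorem corner_Morita : Morita_equivalent A1 add mul A2 add mul.
Proof.
exists ind_functor, corner_functor; split.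
  apply: (@nat_iso_id_of_bij _ _ _ _ _ _ _ _ ind_functor corner_functor point_hom).
  - exact: point_inj.
  - exact: point_surj.
  move=> M N f m; do 2!apply: subz_inj => /=.
  (* An [e] with [e m = m] also fixes [f m], so both points can be written with the same [e]. *)
  have [e e1 em] := act_local_unit lu1 m.
  rewrite (ind_pointE e1 em) (@ind_pointE _ (f m) e) -?hom_act ?em //.
  by apply/funext => q; rewrite /ind_gen /= hom_act.
apply: (@nat_iso_id_of_bij _ _ _ _ _ _ _ _ corner_functor ind_functor eval_hom).
- exact: eval_inj.
- exact: eval_surj.
move=> M N f n; apply: subz_inj; apply/funext => q; apply: subz_inj => /=.
by rewrite !hom_act.
Qed.

End CornerMorita.

(** * Finitely supported sums over a group *)

Lemma ginvKl (G : abs_group) (s t : G) : gmul (ginv s) (gmul s t) = t.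
Proof. by rewrite gmulA gmulV gmul1. Qed.

Lemma ginvKr (G : abs_group) (s t : G) : gmul s (gmul (ginv s) t) = t.
Proof. by rewrite gmulA gmulrV gmul1. Qed.

Lemma gmul_inj (G : abs_group) (s : G) : injective (gmul s).
Proof. by move=> t u /(congr1 (gmul (ginv s))); rewrite !ginvKl. Qed.

Lemma ginv_unique (G : abs_group) (s t : G) : gmul s t = gone G -> t = ginv s.
Proof. by move=> st; apply: (@gmul_inj _ s); rewrite st gmulrV. Qed.

Lemma ginv1 (G : abs_group) : ginv (gone G) = gone G.
Proof. by rewrite -(ginv_unique (gmul1 (gone G))). Qed.

Lemma ginvK (G : abs_group) (s : G) : ginv (ginv s) = s.
Proof. by rewrite -(ginv_unique (gmulV s)). Qed.

Lemma ginvM (G : abs_group) (s t : G) :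
  ginv (gmul s t) = gmul (ginv t) (ginv s).
Proof. by apply/esym/ginv_unique; rewrite -gmulA ginvKr gmulrV. Qed.

Lemma InE (T : Type) (x : {classic T}) (s : seq {classic T}) :
  List.In x s <-> x \in s.
Proof.
elim: s => [|y s IH] //=; rewrite inE; split.
  by move=> [->|/IH ->]; rewrite ?eqxx ?orbT.
by move=> /orP[/eqP ->|/IH]; [left|right].
Qed.

Section FinitelySupportedSums.
Variables (R : comPzRingType) (G : abs_group).
Implicit Types (F : G -> R) (s : seq {classic G}).

Definition gsum F : R := \sum_(g \in [set: {classic G}]) F g.

(** Support bounds are carried explicitly because [gsum] takes the default value 0 on functions of
    infinite support, where it is not additive. *)
Definition supported s F := forall g : {classic G}, g \notin s -> F g = 0.

Lemma gsumE s F : supported s F -> gsum F = \sum_(g <- undup s) F g.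
Proof.
move=> sF; rewrite /gsum (@fsbigE _ _ _ _ _ (undup s)) ?undup_uniq //.
  by apply: eq_bigl => g; rewrite in_setT.
by move=> g _; rewrite mem_undup => /sF.
Qed.

Lemma supported_cat s t F : supported s F -> supported (s ++ t) F.
Proof. by move=> sF g; rewrite mem_cat negb_or => /andP[/sF]. Qed.

Lemma supported_catr s t F : supported t F -> supported (s ++ t) F.
Proof. by move=> sF g; rewrite mem_cat negb_or => /andP[_ /sF]. Qed.

Lemma gsumD s t F F' : supported s F -> supported t F' ->
  gsum (fun g => F g + F' g) = gsum F + gsum F'.
Proof.
move=> sF tF'; rewrite !(@gsumE (s ++ t)) ?big_split //.
- exact: supported_catr.
- exact: supported_cat.
by move=> g gs; rewrite (supported_cat sF gs) (supported_catr tF' gs) addr0.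
Qed.

Lemma gsum_mull s c F : supported s F -> c * gsum F = gsum (fun g => c * F g).
Proof.
move=> sF; rewrite !(@gsumE s) ?big_distrr // => g /sF ->.
by rewrite mulr0.
Qed.

Lemma gsum_mulr s c F : supported s F -> gsum F * c = gsum (fun g => F g * c).
Proof.
by move=> sF; rewrite mulrC (gsum_mull c sF); congr gsum; apply/funext => g; rewrite mulrC.
Qed.

Lemma gsum0 F : (forall g, F g = 0) -> gsum F = 0.
Proof. by move=> F0; rewrite (@gsumE [::]) ?big_nil. Qed.

Lemma gsum_exchange s t (F : G -> G -> R) :
  (forall h, supported s (F^~ h)) -> (forall g, supported t (F g)) ->
  gsum (fun g => gsum (F g)) = gsum (fun h => gsum (F^~ h)).
Proof.
move=> sF tF; rewrite (@gsumE s); last first.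
  by move=> g gs; apply: gsum0 => h; apply: sF.
rewrite (@gsumE t); last first.
  by move=> h ht; apply: gsum0 => g; apply: tF.
under eq_bigr => g _ do rewrite (gsumE (tF g)).
by rewrite exchange_big; apply: eq_bigr => h _; rewrite -(gsumE (sF h)).
Qed.

Lemma gsum_translate g F : gsum F = gsum (fun h => F (gmul g h)).
Proof.
apply: (@reindex_fsbigT _ 0 +%R {classic G} {classic G} (gmul g)).
by exists (gmul (ginv g)) => h; rewrite ?ginvKl ?ginvKr.
Qed.

Lemma gsum_single k F : (forall g, g <> k -> F g = 0) -> gsum F = F k.
Proof.
move=> Fk; rewrite (@gsumE [:: k]) ?big_seq1 // => g.
by rewrite inE => /eqP /Fk.
Qed.

End FinitelySupportedSums.

(** * Locally constant functions on the Stone space *)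

Section StoneFunctions.
Context {disp : Order.disp_t} {L : cbDistrLatticeType disp}.
Variable R : comPzRingType.
Implicit Types (J K : set L) (U V : L) (f : @stone_point disp L -> R).

Lemma stone_ind_meet U V xi :
  stone_ind R (U `&` V)%O xi = stone_ind R U xi * stone_ind R V xi.
Proof.
rewrite /stone_ind; case: asboolP => [[xiP UV]|nUV].
  have [_ [_ [up _]]] := xiP.
  rewrite !asboolT ?mulr1 //; split=> //; apply: up UV _; [exact: leIr|exact: leIl].
case: asboolP => [[xiP xU]|_]; last by rewrite mul0r.
case: asboolP => [[_ xV]|_]; last by rewrite mulr0.
by case: nUV; split=> //; have [_ [_ [_ [cap _]]]] := xiP; apply: cap.
Qed.

Lemma stone_ind_le U V xi : (U <= V)%O ->
  stone_ind R U xi * stone_ind R V xi = stone_ind R U xi.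
Proof. by move=> UV; rewrite -stone_ind_meet; congr stone_ind; apply/eqP; rewrite -leEmeet. Qed.

Lemma stone_ind_eq U V (xi eta : @stone_point disp L) :
  (prime_filter xi /\ xi U <-> prime_filter eta /\ eta V) ->
  stone_ind R U xi = stone_ind R V eta.
Proof. by move=> /propeqP h; rewrite /stone_ind h. Qed.

Lemma Lc_stone_ind J r U : J U -> Lc J (fun xi => r * stone_ind R U xi).
Proof.
move=> JU; exists [:: (r, U)]; split=> [p [<-|]//|].
by apply/funext => xi; rewrite /Lc_comb big_seq1.
Qed.

Lemma Lc_stone_ind1 J U : J U -> Lc J (stone_ind R U).
Proof.
move=> /(Lc_stone_ind 1); congr Lc.
by apply/funext => xi; rewrite mul1r.
Qed.

Lemma Lc0 J : Lc J (fun _ => 0 : R).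
Proof. by exists [::]; split=> //; apply/funext => xi; rewrite /Lc_comb big_nil. Qed.

Lemma LcD J f f' : Lc J f -> Lc J f' -> Lc J (fun xi => f xi + f' xi).
Proof.
move=> [s [sJ ->]] [t [tJ ->]]; exists (s ++ t); split=> [p /In_cat[/sJ|/tJ]//|].
by apply/funext => xi; rewrite /Lc_comb big_cat.
Qed.

Lemma Lc_ind J (P : (@stone_point disp L -> R) -> Prop) :
  P (fun _ => 0) -> (forall f f', P f -> P f' -> P (fun xi => f xi + f' xi)) ->
  (forall r U, J U -> P (fun xi => r * stone_ind R U xi)) ->
  forall f, Lc J f -> P f.
Proof.
move=> P0 PD Pr f [s [sJ ->]]; elim: s sJ => [_|p s IH sJ].
  suff -> : @Lc_comb disp L R [::] = (fun _ => 0) by [].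
  by apply/funext => xi; rewrite /Lc_comb big_nil.
have -> : Lc_comb (p :: s) = (fun xi => p.1 * stone_ind R p.2 xi + Lc_comb s xi)
  by apply/funext => xi; rewrite /Lc_comb big_cons.
by apply: PD; [apply: Pr; apply: sJ; left|apply: IH => q qs; apply: sJ; right].
Qed.

Lemma Lc_subset J K f : (forall U, J U -> K U) -> Lc J f -> Lc K f.
Proof. by move=> JK [s [sJ ->]]; exists s; split=> // p /sJ /JK. Qed.

Lemma LcN J f : Lc J f -> Lc J (fun xi => - f xi).
Proof.
move: f; apply: Lc_ind => [|f1 f2 h1 h2|r U JU].
- by rewrite oppr0; exact: Lc0.
- by under eq_fun do rewrite opprD; exact: LcD.
- by under eq_fun do rewrite -mulNr; exact: Lc_stone_ind.
Qed.

Lemma LcM J J' K f f' : (forall U V, J U -> J' V -> K (U `&` V)%O) ->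
  Lc J f -> Lc J' f' -> Lc K (fun xi => f xi * f' xi).
Proof.
move=> JK Jf J'f'; move: f Jf; apply: Lc_ind.
- by under eq_fun do rewrite mul0r; exact: Lc0.
- by move=> f1 f2 h1 h2; under eq_fun do rewrite mulrDl; exact: LcD.
move=> r U JU; move: f' J'f'; apply: Lc_ind.
- by under eq_fun do rewrite mulr0; exact: Lc0.
- by move=> f1 f2 h1 h2; under eq_fun do rewrite mulrDr; exact: LcD.
move=> q V JV; under eq_fun do rewrite mulrACA -stone_ind_meet.
by apply: Lc_stone_ind; exact: JK.
Qed.

Lemma Lc_sum J (I : Type) (s : seq I) (F : I -> @stone_point disp L -> R) :
  (forall i, Lc J (F i)) -> Lc J (fun xi => \sum_(i <- s) F i xi).
Proof.
move=> JF; elim: s => [|i s IH]; first by under eq_fun do rewrite big_nil; exact: Lc0.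
by under eq_fun do rewrite big_cons; exact: LcD.
Qed.

(** This is how partiality is controlled later: where a coefficient is nonzero, the point is a prime
    filter meeting the ideal of that coefficient. *)
Lemma Lc_support J f xi : Lc J f ->
  f xi = 0 \/ prime_filter xi /\ exists2 U, J U & xi U.
Proof.
move: f; apply: Lc_ind => [|f f' [->|h]|r U JU]; try by [left|right].
  by move=> [->|h]; [left; rewrite addr0|right].
rewrite /stone_ind; case: asboolP => [[xiP xU]|_]; last by left; rewrite mulr0.
by right; split=> //; exists U.
Qed.

End StoneFunctions.

(** * The partial skew group ring as a convolution algebra *)

Section PartialAction.
Context {disp : Order.disp_t} {L : cbDistrLatticeType disp}.
Variables (R : comPzRingType) (G : abs_group).
Variables (I : G -> set L) (phi : G -> L -> L).
Hypothesis pa : partial_action setT I phi.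
Implicit Types (s t g h k : G) (x y U V W : L) (xi : @stone_point disp L).

Lemma pa_le t x y : I t x -> (y <= x)%O -> I t y.
Proof.
move=> tx; rewrite leEmeet meetC => /eqP <-.
by have [/(_ t)[_ [_ [_ IM]]] _] := pa; apply: IM.
Qed.

Lemma pa_bot t : I t \bot%O.
Proof. by have [/(_ t)[_ []]] := pa. Qed.

Lemma pa_join t x y : I t x -> I t y -> I t (x `|` y)%O.
Proof. by have [/(_ t)[_ [_ [IU _]]] _] := pa; apply: IU. Qed.

Lemma pa_meetl t x y : I t x -> I t (x `&` y)%O.
Proof. by move=> tx; apply: pa_le tx _; exact: leIl. Qed.

Lemma pa_dom t x : I (ginv t) x -> I t (phi t x).
Proof. by have [_ [/(_ t)[phiI _] _]] := pa; apply: phiI. Qed.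

Lemma pa_domV t x : I t x -> I (ginv t) (phi (ginv t) x).
Proof. by move=> tx; apply: pa_dom; rewrite ginvK. Qed.

Lemma paU t x y : I (ginv t) x -> I (ginv t) y ->
  phi t (x `|` y)%O = (phi t x `|` phi t y)%O.
Proof. by have [_ [/(_ t)[_ [_ [_ [phiU _]]]] _]] := pa; apply: phiU. Qed.

Lemma paI t x y : I (ginv t) x -> I (ginv t) y ->
  phi t (x `&` y)%O = (phi t x `&` phi t y)%O.
Proof. by have [_ [/(_ t)[_ [_ [_ [_ phiM]]]] _]] := pa; apply: phiM. Qed.

Lemma pa_mono t x y : I (ginv t) y -> (x <= y)%O -> (phi t x <= phi t y)%O.
Proof.
move=> ty xy; have tx := pa_le ty xy.
by move: xy; rewrite !leEmeet -paI // => /eqP ->.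
Qed.

(** [lattice_iso_on] does not mention [\bot]. By surjectivity [\bot] is the image of some [x], and
    monotonicity puts the image of [\bot] below it. *)
Lemma pa_phi_bot t : phi t \bot%O = \bot%O.
Proof.
have [_ [/(_ t)[_ [_ [surj _]]] _]] := pa; have [x tx xE] := surj _ (pa_bot t).
apply/eqP; rewrite -lex0 -[leRHS]xE; apply: pa_mono => //; exact: le0x.
Qed.

Lemma pa_one x : I (gone G) x.
Proof. by have [_ [_ [I1 _]]] := pa; apply/I1. Qed.

Lemma phi_one x : phi (gone G) x = x.
Proof. by have [_ [_ [_ [phi1 _]]]] := pa; apply: phi1. Qed.

Lemma pa_dom_comp s t x : I (ginv s) x -> I t x -> I (gmul s t) (phi s x).
Proof. by move=> sx tx; have [_ [_ [_ [_ [/(_ s t x sx tx)[]]]]]] := pa. Qed.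

Lemma pa_comp s t x : I (ginv t) x -> I (ginv (gmul s t)) x ->
  phi s (phi t x) = phi (gmul s t) x.
Proof. by have [_ [_ [_ [_ [_ [_ comp]]]]]] := pa; apply: comp. Qed.

Lemma phiK t x : I (ginv t) x -> phi (ginv t) (phi t x) = x.
Proof.
by move=> tx; rewrite pa_comp // gmulV ?phi_one // ginv1; exact: pa_one.
Qed.

Lemma phiVK t x : I t x -> phi t (phi (ginv t) x) = x.
Proof. by rewrite -{1}(ginvK t) => /phiK; rewrite ginvK. Qed.

(* The dual partial action on prime filters, composition with which is alpha_g;
   it returns the empty set, which is not a prime filter, where it is undefined. *)
Definition pull g xi : @stone_point disp L := fun x =>
  prime_filter xi /\ exists U, [/\ I (ginv g) U, (U <= x)%O & xi (phi g U)].

Lemma pullE g xi U : prime_filter xi -> I (ginv g) U ->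
  pull g xi U <-> xi (phi g U).
Proof.
move=> xiP gU; split; last by move=> xU; split=> //; exists U.
move=> [_ [V [gV VU xV]]]; have [_ [_ [up _]]] := xiP.
by apply: up xV _; exact: pa_mono.
Qed.

Lemma pull_prime_inv g xi : prime_filter (pull g xi) -> prime_filter xi.
Proof. by move=> [[x []]]. Qed.

Lemma pull_prime g xi U : prime_filter xi -> I (ginv g) U -> xi (phi g U) ->
  prime_filter (pull g xi).
Proof.
move=> xiP gU xU; have [_ [xi0 [up [cap pr]]]] := xiP.
split; first by exists U; apply/pullE.
split.
  move=> [_ [V [_]]]; rewrite lex0 => /eqP -> {V}.
  by rewrite pa_phi_bot.
split=> [x y [_ [V [gV Vx xV]]] xy|].
  by split=> //; exists V; split=> //; exact: le_trans xy.
split=> [x y [_ [V [gV Vx xV]]] [_ [W [gW Wy xW]]]|x y [_ [V [gV Vxy xV]]]].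
  split=> //; exists (V `&` W)%O; split; [exact: pa_meetl|exact: leI2|].
  by rewrite paI //; exact: cap.
(* [x] and [y] may lie outside the domain of [phi g], so primeness of [xi] is applied to the two
   pieces that they cut out of [V]. *)
have gVx : I (ginv g) (V `&` x)%O := pa_meetl _ gV.
have gVy : I (ginv g) (V `&` y)%O := pa_meetl _ gV.
have VE : ((V `&` x) `|` (V `&` y))%O = V.
  by rewrite -meetUr; apply/eqP; rewrite -leEmeet.
move: xV; rewrite -VE paU // => /pr[xV|xV]; [left|right].
  by split=> //; exists (V `&` x)%O; split=> //; exact: leIr.
by split=> //; exists (V `&` y)%O; split=> //; exact: leIr.
Qed.

Lemma stone_ind_pull g U xi : I (ginv g) U ->
  stone_ind R U (pull g xi) = stone_ind R (phi g U) xi.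
Proof.
move=> gU; apply: stone_ind_eq; split=> [[pP pU]|[xiP xU]].
  by have xiP := pull_prime_inv pP; split=> //; apply/pullE.
by split; [exact: pull_prime gU xU|apply/pullE].
Qed.

Lemma stone_ind_pullV g U xi : I g U ->
  stone_ind R U xi = stone_ind R (phi (ginv g) U) (pull g xi).
Proof. by move=> gU; rewrite stone_ind_pull ?phiVK //; exact: pa_domV. Qed.

Lemma Lc_comb_pull g (s : seq (R * L)) xi :
  (forall p, List.In p s -> I (ginv g) p.2) ->
  Lc_comb s (pull g xi) = Lc_comb [seq (p.1, phi g p.2) | p <- s] xi.
Proof.
move=> sI; rewrite /Lc_comb big_map; apply: eq_big_In => p /sI gp.
by rewrite stone_ind_pull.
Qed.

(** The choice in [skew_alpha] asks for one function that fits every presentation of [f].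
    Composition with [pull g] is such a function, which is the well-definedness of alpha_g, and one
    presentation then determines the chosen value. *)
Lemma skew_alphaE g (f : @stone_point disp L -> R) : Lc (I (ginv g)) f ->
  skew_alpha I phi g f = f \o pull g.
Proof.
move=> [s [sI fE]]; rewrite /skew_alpha.
set P := (X in epsilon _ X).
have: P (epsilon (inhabits (fun=> 0)) P).
  apply: epsilon_spec; exists (f \o pull g) => t tI ->.
  by apply/funext => xi /=; exact: Lc_comb_pull.
move=> /(_ s sI fE) ->; apply/funext => xi /=; rewrite fE; exact/esym/Lc_comb_pull.
Qed.

(** The law [phi_g phi_h = phi_{gh}] on filters, with the order reversed. Witnesses are shrunk
    inside the filter until all the partial maps are defined on them. *)
Lemma pull_pull g h xi U : prime_filter xi -> I h U -> pull g xi U ->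
  pull h (pull g xi) = pull (gmul g h) xi.
Proof.
move=> xiP hU [_ [V [gV VU xV]]].
have [_ [_ [up [cap _]]]] := xiP.
have pP : prime_filter (pull g xi) := pull_prime xiP gV xV.
have hV : I h V := pa_le hU VU.
apply/funext => x; apply/propext; split.
  move=> [_ [W [hW Wx [_ [W' [gW' W'W xW']]]]]]; split=> //.
  have hW' : I h W' by apply: pa_le W'W; exact: pa_dom.
  have hg : I (gmul (ginv h) (ginv g)) (phi (ginv h) W').
    by apply: pa_dom_comp; rewrite ?ginvK.
  exists (phi (ginv h) W'); split; first by rewrite ginvM.
    by apply: le_trans Wx; rewrite -(phiK hW); apply: pa_mono => //;
      rewrite ginvK; exact: pa_dom.
  by rewrite -pa_comp ?phiVK ?ginvM //; exact: pa_domV.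
move=> [_ [W [ghW Wx xW]]]; split=> //.
(* [W] may lie outside [I_{h^-1}]. Meeting its image with [phi g V] puts [Z] in [I_g] as well as in
   [I_{gh}], and then the image of [Z] under [phi_{(gh)^-1}] lies in [I_{h^-1}]. *)
set Z := (phi (gmul g h) W `&` phi g V)%O.
have xZ : xi Z by apply: cap.
have ghZ : I (gmul g h) Z by apply: pa_meetl; exact: pa_dom.
have gZ : I g Z by apply: (pa_le (pa_dom gV)); exact: leIr.
set W' := phi (ginv (gmul g h)) Z.
have ghW' : I (ginv (gmul g h)) W' by exact: pa_domV.
have hW' : I (ginv h) W'.
  have -> : ginv h = gmul (ginv (gmul g h)) g
    by rewrite ginvM -gmulA gmulV gmulr1.
  by apply: pa_dom_comp; rewrite ?ginvK.
exists W'; split=> //.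
  apply: le_trans Wx; rewrite -(phiK ghW); apply: pa_mono; last exact: leIl.
  by rewrite ginvK; exact: pa_dom.
split=> //; exists (phi h W'); split=> //.
  have -> : ginv g = gmul h (ginv (gmul g h)) by rewrite ginvM ginvKr.
  exact: pa_dom_comp.
by rewrite pa_comp // phiVK.
Qed.

Lemma pull_one xi : prime_filter xi -> pull (gone G) xi = xi.
Proof.
move=> xiP; have [_ [_ [up _]]] := xiP.
apply/funext => x; apply/propext; split.
  by move=> [_ [U [_ Ux]]]; rewrite phi_one => /up; apply.
move=> xx; split=> //; exists x.
by rewrite phi_one ginv1; split=> //; exact: pa_one.
Qed.

(** Away from prime filters, where [pull_one] does not apply, both sides vanish. *)
Lemma Lc_pull_one J (f : @stone_point disp L -> R) xi :
  Lc J f -> f (pull (gone G) xi) = f xi.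
Proof.
move=> Jf; have [f0|[xiP _]] := Lc_support xi Jf; last by rewrite pull_one.
have [f1|[pP _]] := Lc_support (pull (gone G) xi) Jf; first by rewrite f0.
by rewrite pull_one //; exact: pull_prime_inv pP.
Qed.

Lemma Lc_pull g (f : @stone_point disp L -> R) :
  Lc (I g) f -> Lc (I (ginv g)) (f \o pull (ginv g)).
Proof.
move: f; apply: Lc_ind => [|f f'|r U gU]; [exact: Lc0|exact: LcD|].
have -> : (fun xi => r * stone_ind R U xi) \o pull (ginv g) =
    fun xi => r * stone_ind R (phi (ginv g) U) xi.
  by apply/funext => xi /=; rewrite stone_ind_pull ?ginvK.
by apply: Lc_stone_ind; exact: pa_domV.
Qed.

Lemma Lc_pull_pull g (f : @stone_point disp L -> R) xi :
  Lc (I g) f -> f (pull (ginv g) (pull g xi)) = f xi.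
Proof.
move: f; apply: Lc_ind => // [f f' -> -> //|r U gU].
by rewrite stone_ind_pull ?ginvK // -stone_ind_pullV.
Qed.

(** For [f = r 1_U] and [f' = q 1_V] the result is [r q 1_W] with [W = phi_g (phi_{g^-1} U /\ V)],
    the product rule for [U delta_g] and [V delta_h]. [K] stays free: it is an ideal [I k] for
    closure under products, and a family of cut elements for the corner. *)
Lemma Lc_twist g J J' K (f f' : @stone_point disp L -> R) :
  (forall U, J U -> I g U) ->
  (forall U V, J U -> J' V -> K (phi g (phi (ginv g) U `&` V)%O)) ->
  Lc J f -> Lc J' f' -> Lc K (fun xi => f xi * f' (pull g xi)).
Proof.
move=> Jg JK Jf J'f'; move: f Jf; apply: Lc_ind.
- by under eq_fun do rewrite mul0r; exact: Lc0.
- by move=> f1 f2 h1 h2; under eq_fun do rewrite mulrDl; exact: LcD.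
move=> r U JU; move: f' J'f'; apply: Lc_ind.
- by under eq_fun do rewrite mulr0; exact: Lc0.
- by move=> f1 f2 h1 h2; under eq_fun do rewrite mulrDr; exact: LcD.
move=> q V JV; have gU := Jg _ JU.
have -> : (fun xi => r * stone_ind R U xi * (q * stone_ind R V (pull g xi))) =
    fun xi => r * q * stone_ind R (phi g (phi (ginv g) U `&` V)%O) xi.
  apply/funext => xi; rewrite mulrACA (stone_ind_pullV _ gU) -stone_ind_meet.
  by rewrite stone_ind_pull //; exact/pa_meetl/pa_domV.
by apply: Lc_stone_ind; exact: JK.
Qed.

(** * The convolution product and its associativity *)

Notation elt := (@skew_elt disp L R G).
Implicit Types (a b c : elt).
Local Notation "a ** b" := (skew_mul I phi a b) (at level 40, left associativity).
Local Notation mem := (skew_mem I).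

Definition skew_support (s : seq {classic G}) a : Prop :=
  forall g : {classic G}, g \notin s -> forall xi, a g xi = 0.

Lemma skew_memP (J : G -> set L) a : skew_mem J a <->
  (exists s : seq {classic G}, skew_support s a) /\ forall g, Lc (J g) (a g).
Proof.
split=> -[[s sa] Ja]; split=> //; exists s => g.
  by move=> gs xi; rewrite sa // => /InE; apply/negP.
move=> gs; apply/funext => xi; apply: sa; apply/negP => /InE; exact: gs.
Qed.

(** Since alpha_g is composition with [pull g], it is multiplicative, and it undoes the alpha_{g^-1}
    applied to [a g]; only [b] remains twisted. *)
Lemma skew_mulE a b k xi : (forall g, Lc (I g) (a g)) -> (forall g, Lc (I g) (b g)) ->
  (a ** b) k xi = gsum (fun g => a g xi * b (gmul (ginv g) k) (pull g xi)).
Proof.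
move=> Ia Ib; rewrite /skew_mul -/(gsum _); congr gsum; apply/funext => g.
rewrite (@skew_alphaE (ginv g)) ?ginvK // skew_alphaE /= ?Lc_pull_pull //.
apply: (LcM (J := I (ginv g)) (J' := setT)); [|exact: Lc_pull|].
  by move=> U V gU _; exact: pa_meetl.
by apply: Lc_subset (Ib _).
Qed.

Definition mul_seq (s t : seq {classic G}) : seq {classic G} :=
  [seq gmul u v | u <- s, v <- t].

Lemma skew_mul_support (s t : seq {classic G}) a b : skew_support s a -> skew_support t b ->
  forall g h (xi eta : @stone_point disp L), (g : {classic G}) \notin mul_seq s t ->
  a h xi * b (gmul (ginv h) g) eta = 0.
Proof.
move=> sa tb g h xi eta gst; have [hs|/sa->] := boolP (h \in s); last by rewrite mul0r.
rewrite tb ?mulr0 //; apply: contraNN gst => ht.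
by rewrite -[g](ginvKr h); exact: (@allpairs_f {classic G} {classic G} {classic G} (@gmul G)).
Qed.

Lemma mem_skew_mul a b : mem a -> mem b -> mem (a ** b).
Proof.
move=> /skew_memP[[s sa] Ia] /skew_memP[[t tb] Ib]; apply/skew_memP; split.
  exists (mul_seq s t) => g gst xi; rewrite skew_mulE //.
  by apply: gsum0 => h; exact: skew_mul_support gst.
move=> k; have -> : (a ** b) k =
    fun xi => \sum_(g <- undup s) a g xi * b (gmul (ginv g) k) (pull g xi).
  apply/funext => xi; rewrite skew_mulE //; apply: gsumE => g gs.
  by rewrite sa ?mul0r.
apply: Lc_sum => g; apply: (Lc_twist _ _ (Ia g) (Ib _)) => // U V gU gV.
rewrite -[k](ginvKr g); apply: pa_dom_comp; first exact/pa_meetl/pa_domV.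
by rewrite meetC; exact: pa_meetl.
Qed.

Lemma skew_mulA a b c : mem a -> mem b -> mem c -> a ** (b ** c) = a ** b ** c.
Proof.
move=> a2 b2 c2; have [_ Iab] := mem_skew_mul a2 b2.
have [_ Ibc] := mem_skew_mul b2 c2.
move: a2 b2 c2 => /skew_memP[[s sa] Ia] /skew_memP[[t tb] Ib] /skew_memP[[u uc] Ic].
apply/funext => k; apply/funext => xi; rewrite !skew_mulE //.
(* Here [h] is the degree of the product of the first two factors. The right bracketing is indexed
   by the degree of [b] alone, hence the translation by [g] below. *)
pose F g h := a g xi * b (gmul (ginv g) h) (pull g xi)
              * c (gmul (ginv h) k) (pull h xi).
transitivity (gsum (fun g => gsum (F g))).
  congr gsum; apply/funext => g; rewrite skew_mulE // (@gsum_mull _ _ t); last first.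
    by move=> h ht; rewrite tb ?mul0r.
  rewrite (gsum_translate g (F g)); congr gsum; apply/funext => h.
  rewrite /F ginvKl ginvM -gmulA -mulrA; congr (_ * _).
  (* Either [b h] vanishes at [pull g xi] and so do both terms, or that point is a prime filter
     meeting [I h], and [pull_pull] applies. *)
  have [->|[pP [U hU pU]]] := Lc_support (pull g xi) (Ib h); first by rewrite !mul0r.
  by rewrite (pull_pull (pull_prime_inv pP) hU pU).
rewrite (@gsum_exchange _ _ s (mul_seq s t)).
- congr gsum; apply/funext => h; rewrite skew_mulE // (@gsum_mulr _ _ s) //.
  by move=> g gs; rewrite sa ?mul0r.
- by move=> h g gs; rewrite /F sa ?mul0r.
- by move=> g h hst; rewrite /F (skew_mul_support sa tb) ?mul0r.
Qed.

Lemma mem_skew_add (J : G -> set L) a b : skew_mem J a -> skew_mem J b ->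
  skew_mem J (skew_add a b).
Proof.
move=> /skew_memP[[s sa] Ia] /skew_memP[[t tb] Ib]; apply/skew_memP.
split; last by move=> g; exact: LcD.
exists (s ++ t) => g; rewrite mem_cat negb_or => /andP[gs gt] xi.
by rewrite /skew_add sa // tb // addr0.
Qed.

Lemma skew_mulDl a b c : mem a -> mem b -> mem c ->
  skew_add a b ** c = skew_add (a ** c) (b ** c).
Proof.
move=> a2 b2 c2; have [_ Iab] := mem_skew_add a2 b2.
move: a2 b2 c2 => /skew_memP[[s sa] Ia] /skew_memP[[t tb] Ib] [_ Ic].
apply/funext => k; apply/funext => xi; rewrite /skew_add !skew_mulE //.
rewrite -(@gsumD _ _ s t).
- by congr gsum; apply/funext => g; rewrite mulrDl.
- by move=> g gs; rewrite sa ?mul0r.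
- by move=> g gs; rewrite tb ?mul0r.
Qed.

Lemma skew_mulDr a b c : mem a -> mem b -> mem c ->
  a ** skew_add b c = skew_add (a ** b) (a ** c).
Proof.
move=> a2 b2 c2; have [_ Ibc] := mem_skew_add b2 c2.
move: a2 b2 c2 => /skew_memP[[s sa] Ia] [_ Ib] [_ Ic].
apply/funext => k; apply/funext => xi; rewrite /skew_add !skew_mulE //.
rewrite -(@gsumD _ _ s s).
- by congr gsum; apply/funext => g; rewrite mulrDr.
- by move=> g gs; rewrite sa ?mul0r.
- by move=> g gs; rewrite sa ?mul0r.
Qed.

Lemma skew_is_rng : is_rng mem (@skew_zero disp L R G) (@skew_add disp L R G)
  (@skew_opp disp L R G) (skew_mul I phi).
Proof.
split.
- by split; [exists [::]|move=> g; exact: Lc0].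
- exact: mem_skew_add.
- move=> a /skew_memP[[s sa] Ia]; apply/skew_memP; split.
    by exists s => g gs xi; rewrite /skew_opp sa ?oppr0.
  by move=> g; exact: LcN.
- exact: mem_skew_mul.
- by apply/funext => g; apply/funext => xi; exact: addr0.
- by move=> a _; apply/funext => g; apply/funext => xi; exact: subrr.
- exact: skew_mulA.
- exact: skew_mulDl.
- exact: skew_mulDr.
Qed.

Definition skew_unit U : elt := fun g xi => if pselect (g = gone G) then stone_ind R U xi else 0.

Lemma mem_skew_unit (J : G -> set L) U : J (gone G) U -> skew_mem J (skew_unit U).
Proof.
move=> JU; apply/skew_memP; split.
  exists [:: gone G] => g; rewrite inE /skew_unit => /eqP ge xi.
  by case: pselect.
move=> g; rewrite /skew_unit; case: pselect => ge /=; last exact: Lc0.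
by rewrite ge; exact: Lc_stone_ind1.
Qed.

Lemma skew_unit_mul U a k xi : (forall g, Lc (I g) (a g)) ->
  (skew_unit U ** a) k xi = stone_ind R U xi * a k xi.
Proof.
move=> Ia; have [_ IU] := mem_skew_unit (pa_one U).
rewrite skew_mulE // (gsum_single (k := gone G)).
  by rewrite ginv1 gmul1 (Lc_pull_one _ (Ia k)) /skew_unit; case: pselect.
by move=> g ge; rewrite /skew_unit; case: pselect => // ? /=; rewrite mul0r.
Qed.

Lemma skew_mul_unit U a k xi : (forall g, Lc (I g) (a g)) ->
  (a ** skew_unit U) k xi = a k xi * stone_ind R U (pull k xi).
Proof.
move=> Ia; have [_ IU] := mem_skew_unit (pa_one U).
rewrite skew_mulE // (gsum_single (k := k)).
  by rewrite gmulV /skew_unit; case: pselect.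
move=> g gk; rewrite /skew_unit; case: pselect => [e|ne] /=; last by rewrite mulr0.
by case: gk; rewrite -[k](ginvKr g) e gmulr1.
Qed.

(** All [V] above [U] are included, so that the join of two dominating elements dominates both ring
    elements. *)
Definition dominates U a : Prop := forall V, (U <= V)%O ->
  skew_unit V ** a = a /\ a ** skew_unit V = a.

(** * Local units, treated at once for A2 and for A1 inside A2 *)

Section LocalUnits.
Variables (B : set L) (J : G -> set L).
Hypothesis B0 : B \bot%O.
Hypothesis BU : forall x y, B x -> B y -> B (x `|` y)%O.
Hypothesis JB : forall k x, J k x -> B x.
Hypothesis JVB : forall k x, J k x -> B (phi (ginv k) x).
Hypothesis JI : forall k x, J k x -> I k x.

(** For [r 1_U delta_k], a left unit is [U] and a right unit is [phi_{k^-1} U]; their join serves on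
    both sides. *)
Lemma Lc_dominated k (f : @stone_point disp L -> R) : Lc (J k) f ->
  exists2 U, B U & forall V, (U <= V)%O -> forall xi,
    stone_ind R V xi * f xi = f xi /\ f xi * stone_ind R V (pull k xi) = f xi.
Proof.
move: f; apply: Lc_ind.
- by exists \bot%O => // V _ xi; rewrite mulr0 mul0r.
- move=> f f' [U BU1 fU] [U' BU' fU']; exists (U `|` U')%O; first exact: BU.
  move=> V; rewrite leUx => /andP[/fU{}fU /fU'{}fU'] xi.
  by rewrite mulrDr mulrDl !(fU xi).1 !(fU xi).2 !(fU' xi).1 !(fU' xi).2.
move=> r U JU; exists (U `|` phi (ginv k) U)%O; first by apply: BU; [exact: JB JU|exact: JVB].
move=> V; rewrite leUx => /andP[UV UV'] xi; split.
  by rewrite mulrCA [stone_ind _ V _ * _]mulrC stone_ind_le.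
by rewrite -mulrA (stone_ind_pullV _ (JI JU)) stone_ind_le.
Qed.

Lemma exists_dominates a : skew_mem J a -> exists2 U, B U & dominates U a.
Proof.
move=> /skew_memP[[s sa] Ja].
have [U B_U aU] : exists2 U, B U & forall V, (U <= V)%O ->
    forall k : {classic G}, k \in s -> forall xi,
    stone_ind R V xi * a k xi = a k xi /\ a k xi * stone_ind R V (pull k xi) = a k xi.
  elim: s {sa} => [|k s [U B_U aU]]; first by exists \bot%O.
  have [W B_W aW] := Lc_dominated (Ja k).
  exists (W `|` U)%O; first exact: BU.
  move=> V; rewrite leUx => /andP[WV UV] h; rewrite inE => /orP[/eqP ->|hs] xi.
    exact: aW.
  exact: aU.
exists U => // V /aU aV; have Ia k : Lc (I k) (a k) := Lc_subset (@JI k) (Ja k).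
split; apply/funext => k; apply/funext => xi; rewrite ?skew_unit_mul ?skew_mul_unit //;
  have [ks|ks] := boolP ((k : {classic G}) \in s).
- by rewrite (aV k ks xi).1.
- by rewrite sa ?mulr0.
- by rewrite (aV k ks xi).2.
- by rewrite sa ?mul0r.
Qed.

Lemma skew_local_units : (forall U, B U -> J (gone G) U) ->
  local_units (skew_mem (R := R) J) (skew_mul I phi).
Proof.
move=> BJ s sJ.
suff [U B_U sU] : exists2 U, B U & forall a, List.In a s -> dominates U a.
  exists (skew_unit U) => [|a /sU/(_ U (lexx U))//].
  by apply: mem_skew_unit; exact: BJ.
elim: s sJ => [_|a s IH sJ]; first by exists \bot%O.
have [U B_U aU] : exists2 U, B U & dominates U a.
  by apply: exists_dominates; apply: sJ; left.
have [|W B_W sW] := IH; first by move=> b bs; apply: sJ; right.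
exists (U `|` W)%O; first exact: BU.
move=> b [<- V|/sW bW V]; rewrite leUx => /andP[UV WV]; [exact: aU|exact: bW].
Qed.

End LocalUnits.

End PartialAction.

Local Close Scope ring_scope.

(** * Partial subactions *)

Lemma big_join_ind (disp : Order.disp_t) (L : bJoinSemilatticeType disp)
    (P : L -> Prop) (s : seq L) :
  P \bot%O -> (forall u v, P u -> P v -> P (u `|` v)%O) ->
  (forall c, List.In c s -> P c) -> P (\join_(c <- s) c)%O.
Proof.
move=> P0 PU; elim: s => [|c s IH] sP; first by rewrite big_nil.
rewrite big_cons; apply: PU; first by apply: sP; left.
by apply: IH => d ds; apply: sP; right.
Qed.

Section SubactionCorner.
Context {disp : Order.disp_t} {L : cbDistrLatticeType disp}.
Variables (R : comPzRingType) (G : abs_group).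
Variables (B1 : set L) (I1 : G -> set L) (phi1 : G -> L -> L).
Variables (I2 : G -> set L) (phi2 : G -> L -> L).
Hypothesis Hsub : partial_subaction B1 I1 phi1 I2 phi2.
Hypothesis H1 : gba_ideal setT B1.
Variables (C1 : set L) (C : G -> set L).
Hypotheses (HC1 : gba_cover B1 C1) (HCsub : forall g x, C g x -> I2 g x).
Hypothesis HC : forall g, gba_cover (I2 g) (C g).
Hypothesis H2 : forall (g : G) (X Y V : L), C1 X -> C1 Y -> C (ginv g) V ->
  exists Z, I1 g Z /\ (X `&` phi2 g (Y `&` V) <= Z)%O.

Let pa2 : partial_action setT I2 phi2.
Proof. by have [_ [_ []]] := Hsub. Qed.

Let pa1 : partial_action B1 I1 phi1.
Proof. by have [_ []] := Hsub. Qed.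

Let sub12 t x : I1 t x -> I2 t x.
Proof. by have [_ [_ [_ [sub _]]]] := Hsub; apply: sub. Qed.

Let ideal1 t : gba_ideal B1 (I1 t).
Proof. by have [/(_ t)] := pa1. Qed.

(** The expression turns joins in each of its three variables into joins, and [I1 g] is closed under
    joins. The bound assumed on the covers therefore passes to finite joins of their members, one
    variable at a time. *)
Lemma corner_dominated g X Y V : B1 X -> B1 Y -> I2 (ginv g) V ->
  exists2 Z, I1 g Z & (X `&` phi2 g (Y `&` V) <= Z)%O.
Proof.
pose Q X Y V := exists2 Z, I1 g Z & (X `&` phi2 g (Y `&` V) <= Z)%O.
have [_ [I10 [I1U _]]] := ideal1 g.
have Q0 x y z : (x `&` phi2 g (y `&` z) = \bot)%O -> Q x y z.
  by move=> e; exists \bot%O; rewrite ?e ?le0x.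
have QU x y z x' y' z' x'' y'' z'' : 
    (x `&` phi2 g (y `&` z) = (x' `&` phi2 g (y' `&` z')) `|` (x'' `&` phi2 g (y'' `&` z'')))%O ->
    Q x' y' z' -> Q x'' y'' z'' -> Q x y z.
  move=> e [Z gZ hZ] [W gW hW]; exists (Z `|` W)%O; first exact: I1U.
  by rewrite e; exact: leU2.
have meetV y z : I2 (ginv g) z -> I2 (ginv g) (y `&` z)%O.
  by move=> gz; rewrite meetC; exact: (pa_meetl pa2).
move=> BX BY gV; have [cs [csC Vcs]] := HC gV.
have [ys [ysC Yys]] := HC1 BY; have [xs [xsC Xxs]] := HC1 BX.
have csI (s : seq L) : (forall c, List.In c s -> C (ginv g) c) ->
    I2 (ginv g) (\join_(c <- s) c)%O.
  move=> sC; apply: (@big_join_ind _ _ (I2 (ginv g))).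
  - exact: (pa_bot pa2).
  - exact: (pa_join pa2).
  - by move=> c /sC; exact: HCsub.
have Qx x y : C1 x -> C1 y -> Q x y (\join_(c <- cs) c)%O.
  (* Membership in [I2 (ginv g)] is carried along because [phi2 g] preserves joins only there. *)
  move=> Cx Cy; suff [] : I2 (ginv g) (\join_(c <- cs) c)%O /\ Q x y (\join_(c <- cs) c)%O by [].
  apply: (@big_join_ind _ _ (fun V => I2 (ginv g) V /\ Q x y V)).
  - by split; [exact: (pa_bot pa2)|apply: Q0; rewrite meetx0 (pa_phi_bot pa2) meetx0].
  - move=> u v [gu Qu] [gv Qv]; split; first exact: (pa_join pa2).
    by apply: QU Qu Qv; rewrite meetUr (paU pa2) ?meetUr //; exact: meetV.
  - move=> c /csC Cc; split; first exact: HCsub.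
    by have [Z [gZ hZ]] := H2 Cx Cy Cc; exists Z.
set W := (\join_(c <- cs) c)%O in Qx Vcs; have gW : I2 (ginv g) W := csI _ csC.
have Qy x : C1 x -> Q x (\join_(y <- ys) y)%O W.
  move=> Cx; apply: (@big_join_ind _ _ (fun y => Q x y W)).
  - by apply: Q0; rewrite meet0x (pa_phi_bot pa2) meetx0.
  - by move=> u v; apply: QU; rewrite meetUl (paU pa2) ?meetUr //; exact: meetV.
  - by move=> y /ysC; exact: Qx.
set Y' := (\join_(y <- ys) y)%O in Qy Yys.
have [Z gZ hZ] : Q (\join_(x <- xs) x)%O Y' W.
  apply: (@big_join_ind _ _ (fun x => Q x Y' W)).
  - by apply: Q0; rewrite meet0x.
  - by move=> u v; apply: QU; rewrite meetUl.
  - by move=> x /xsC; exact: Qy.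
(* [X], [Y] and [V] lie below the three joins, and the expression is monotone in each. *)
exists Z => //; apply: le_trans hZ; apply: leI2 => //.
by apply: (pa_mono pa2); [exact: meetV|exact: leI2].
Qed.

Lemma corner_elt g X Y V : B1 X -> B1 Y -> I2 (ginv g) V ->
  I1 g (X `&` phi2 g (Y `&` V))%O.
Proof.
move=> BX BY gV; have [Z gZ hZ] := corner_dominated BX BY gV.
have [_ [_ [_ B1I]]] := H1; have [_ [_ [_ I1M]]] := ideal1 g.
move: hZ; rewrite leEmeet meetC => /eqP <-; apply: I1M => //.
exact: B1I.
Qed.

Let B10 : B1 \bot%O. Proof. by have [_ []] := H1. Qed.

Let B1U x y : B1 x -> B1 y -> B1 (x `|` y)%O.
Proof. by have [_ [_ [BU _]]] := H1; apply: BU. Qed.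

Let I1B k x : I1 k x -> B1 x.
Proof. by have [IB _] := ideal1 k; apply: IB. Qed.

Let I1VB k x : I1 k x -> B1 (phi2 (ginv k) x).
Proof.
move=> kx; have [_ [_ [_ [_ eq12]]]] := Hsub.
have [_ [/(_ (ginv k))[phiI _] _]] := pa1.
have kx' : I1 (ginv (ginv k)) x by rewrite ginvK.
by rewrite eq12 //; apply: (@I1B (ginv k)); exact: phiI.
Qed.

Lemma subaction_local_units :
  local_units (skew_mem (R := R) I1) (skew_mul I2 phi2).
Proof.
apply: (skew_local_units pa2 B10 B1U I1B I1VB sub12).
by move=> U; have [_ [_ [/(_ U)[_ I1e] _]]] := pa1.
Qed.

Lemma subaction_mem (a : @skew_elt disp L R G) : skew_mem I1 a -> skew_mem I2 a.
Proof. by move=> [sa Ia]; split=> // g; exact: Lc_subset (@sub12 g) (Ia g). Qed.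

(** With [U], [V] in [B1] a left unit of [a] and a right unit of [b], the product [y] equals
    [U y V], so [y k] is multiplied by [1_U] and by [1_V] composed with [pull k]. No sum over the
    group is left, and [corner_elt] applies to each term of [y k]. *)
Lemma subaction_corner (a x b : @skew_elt disp L R G) :
  skew_mem I1 a -> skew_mem I2 x -> skew_mem I1 b ->
  skew_mem I1 (skew_mul I2 phi2 (skew_mul I2 phi2 a x) b).
Proof.
move=> a1 x2 b1; have a2 := subaction_mem a1; have b2 := subaction_mem b1.
have [U BU /(_ U (lexx U))[Ua _]] := exists_dominates pa2 B10 B1U I1B I1VB sub12 a1.
have [V BV /(_ V (lexx V))[_ bV]] := exists_dominates pa2 B10 B1U I1B I1VB sub12 b1.
have u2 W : skew_mem I2 (@skew_unit _ L R G W).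
  by apply: mem_skew_unit; exact: (pa_one pa2).
have ax2 := mem_skew_mul pa2 a2 x2; set y := skew_mul I2 phi2 _ b.
have y2 : skew_mem I2 y by exact: mem_skew_mul.
have [fy Iy] := y2; split=> // k.
have Uy : skew_mul I2 phi2 (skew_unit R U) y = y.
  by rewrite /y !(skew_mulA pa2) ?Ua //; exact: mem_skew_mul.
have yV : skew_mul I2 phi2 y (skew_unit R V) = y.
  by rewrite /y -(skew_mulA pa2) ?bV.
have -> : y k = fun xi => (stone_ind R U xi *
    (y k xi * stone_ind R V (pull I2 phi2 k xi)))%R.
  apply/funext => xi; rewrite -(skew_mul_unit pa2) // yV.
  by rewrite -(skew_unit_mul pa2) // Uy.
(* [J] collects what remains of [W] in [I2 k] after cutting by [V] on the right, with
   [V' = phi_{k^-1} W]; the cut by [U] on the left comes second. *)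
pose J W := exists2 V', I2 (ginv k) V' & W = phi2 k (V `&` V')%O.
apply: (LcM (J := [set U]%classic) (J' := J)).
- by move=> X W -> [V' kV' ->]; exact: corner_elt.
- exact: Lc_stone_ind1.
apply: (Lc_twist pa2 (J := I2 k) (J' := [set V]%classic)) => //.
- move=> W V' kW ->; exists (phi2 (ginv k) W); first exact: (pa_domV pa2).
  by rewrite meetC.
- exact: Lc_stone_ind1.
Qed.

End SubactionCorner.

Theorem theorem4p15 (R : comPzRingType) (G : abs_group)
    (disp : Order.disp_t) (L : cbDistrLatticeType disp)
    (B1 : set L) (I1 : G -> set L) (phi1 : G -> L -> L)
    (I2 : G -> set L) (phi2 : G -> L -> L)
    (Hsub : partial_subaction B1 I1 phi1 I2 phi2)
    (* (1) B1 is an ideal of B2 *)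
    (H1 : gba_ideal setT B1)
    (* (2) covers *)
    (C1 : set L) (C : G -> set L)
    (HC1sub : forall x, C1 x -> B1 x) (HC1 : gba_cover B1 C1)
    (HCsub : forall g x, C g x -> I2 g x) (HC : forall g, gba_cover (I2 g) (C g))
    (H2 : forall (g : G) (X Y V : L), C1 X -> C1 Y -> C (ginv g) V ->
        exists Z, I1 g Z /\ (X `&` phi2 g (Y `&` V) <= Z)%O)
    (* (3) A1 is contained in no proper two-sided ideal of A2 *)
    (H3 : forall Jd : @skew_elt disp L R G -> Prop,
        two_sided_ideal (skew_mem I2) (@skew_zero disp L R G) (@skew_add disp L R G)
          (skew_mul I2 phi2) (@skew_opp disp L R G) Jd ->
        (forall a, skew_mem I1 a -> Jd a) ->
        forall a, skew_mem I2 a -> Jd a) :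
  Morita_equivalent
    (skew_mem I1) (@skew_add disp L R G) (skew_mul I2 phi2)
    (skew_mem I2) (@skew_add disp L R G) (skew_mul I2 phi2).
Proof.
have pa2 : partial_action setT I2 phi2 by have [_ [_ []]] := Hsub.
apply: (corner_Morita (skew_is_rng R pa2)).
- exact: (subaction_local_units Hsub H1).
- by apply: (skew_local_units pa2 (B := setT)) => // U _; exact: (pa_one pa2).
- exact: (subaction_mem Hsub).
- exact: (subaction_corner Hsub H1 HC1 HCsub HC H2).
- exact: H3.
Qed.
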